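(* Let $\mathcal{K}=\{k_1,\dots,k_J\}\subset(0,\infty)$ be a finite set of distinct frequencies. Then there exist non-trivial sources $g\in L^2(\Omega)$, $g\neq0$, that are simultaneously non-radiating at all the frequencies $k_1,\dots,k_J$. Hence, for the multi-frequency inverse source problem (given the traces $\gamma u_k$ on $\Gamma$ for all $k\in\mathcal{K}$, where $u_k$ solves the Direct Problem at frequency $k$ with an unknown source $f\in L^2(\Omega)$, find $f$), boundary data obtained from finitely many frequencies is not sufficient to recover the unknown source $f$ uniquely.
   Context: Setting. $\Omega\subset\mathbb{R}^3$ is a bounded open domain with Lipschitz boundary $\Gamma$. The coefficients $a,b$ are real valued with $a,b\in L^{\infty}(\Omega)$; there is a constant $a_0$ with $0<a_0\le a(x)$; $b>0$ and $b^{-1}\in L^{\infty}(\Omega)$; and the supports of $1-a$ and $1-b$ lie within $\Omega$. $h=h(k)$ is a known function of the frequency $k>0$ with $h(k)\neq0$. All function spaces consist of complex-valued functions; $\langle\cdot,\cdot\rangle_{L^2}$ denotes the sesquilinear $L^2$ inner product (linear in the first argument), and on $\Gamma$ also its extension to the duality pairing between $H^{-1/2}(\Gamma)$ and $H^{1/2}(\Gamma)$. $\gamma:H^1(\Omega)\to H^{1/2}(\Gamma)$ is the trace operator. For $k>0$, $\Lambda_k:H^{1/2}(\Gamma)\to H^{-1/2}(\Gamma)$ is the exterior Dirichlet-to-Neumann map: $\Lambda_k \varphi=\partial_\nu v$ on $\Gamma$, where $v\in H^1_{\rm loc}(\mathbb{R}^3\setminus\overline{\Omega})$ is the solution (its existence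 and uniqueness being taken as known) of $\Delta v+k^2v=0$ in $\mathbb{R}^3\setminus\overline{\Omega}$ with $v=\varphi$ on $\Gamma$ satisfying the Sommerfeld radiation condition $\lim_{r\to\infty}r(\partial_r v-ikv)=0$, $r=|x|$; $\nu$ is the unit normal on $\Gamma$ pointing out of $\Omega$. Direct Problem at frequency $k>0$: given $f\in L^2(\Omega)$, find $u=u_k\in H^1(\Omega)$ with $$\langle a\nabla u,\nabla v\rangle_{L^2(\Omega)}-k^2\langle bu,v\rangle_{L^2(\Omega)}-\langle\Lambda_k\gamma u,\gamma v\rangle_{L^2(\Gamma)}=h(k)\langle f,v\rangle_{L^2(\Omega)}\quad\text{for all }v\in H^1(\Omega).$$ It is taken as known that for every $k>0$ this problem has a unique solution $u_k\in H^1(\Omega)$, depending continuously on $f\in L^2(\Omega)$. A source $g\in L^2(\Omega)$ is non-radiating at frequency $k$ if the solution $u_k$ of the Direct Problem at frequency $k$ with source $g$ satisfies $\gamma u_k=0$ on $\Gamma$. *)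

(* Defs.v *)
From HB Require Import structures.
From mathcomp Require Import all_boot all_order all_algebra.
From mathcomp Require Import complex.
From mathcomp Require Import all_classical all_reals all_analysis.

Set Implicit Arguments.
Unset Strict Implicit.
Unset Printing Implicit Defensive.

Import Order.TTheory GRing.Theory Num.Theory numFieldNormedType.Exports.

Local Open Scope classical_set_scope.
Local Open Scope complex_scope.
Local Open Scope ring_scope.

(* R^3.  The product type carries the product topology, the maximum norm and
   the Borel sigma-algebra; the Euclidean norm is [enorm] below. *)
Notation R3 R := (R * R * R)%type.

Definition coord (R : realType) (x : R3 R) (i : 'I_3) : R :=
  [:: x.1.1; x.1.2; x.2]`_i.

Definition basis (R : realType) (i : 'I_3) : R3 R :=
  ((i == 0%N :> nat)%:R, (i == 1%N :> nat)%:R, (i == 2%N :> nat)%:R).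

Definition enorm (R : realType) (x : R3 R) : R :=
  Num.sqrt (\sum_(i < 3) coord x i ^+ 2).

Definition eball (R : realType) (rho : R) : set (R3 R) :=
  [set x | enorm x < rho].

(* The same carrier, with the Borel sigma-algebra made explicit. *)
Notation mR3 R := (measurableTypeR R * measurableTypeR R * measurableTypeR R)%type.

Definition vol (R : realType) : {measure set (mR3 R) -> \bar R} :=
  ((@lebesgue_measure R \x @lebesgue_measure R) \x @lebesgue_measure R)%E.

(* The exterior domain R^3 \ closure Omega, and the boundary of Omega (used
   only for open Omega). *)
Definition exterior (R : realType) (Omega : set (R3 R)) : set (R3 R) :=
  ~` closure Omega.

Definition boundary (R : realType) (Omega : set (R3 R)) : set (R3 R) :=
  closure Omega `\` Omega.

(* Near every boundary point, in suitable orthonormal coordinates y = Q x, the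
   set Omega is the hypograph of a Lipschitz function of (y_0, y_1). *)
Definition lipschitz_boundary (R : realType) (Omega : set (R3 R)) : Prop :=
  forall x0, boundary Omega x0 ->
  exists (Q : 'M[R]_3) (L : R) (zeta : R -> R -> R),
    let y (x : R3 R) (i : 'I_3) := \sum_(j < 3) Q i j * coord x j in
    [/\ Q *m Q^T = 1%:M,
        forall s t s' t',
          `|zeta s t - zeta s' t'| <= L * (`|s - s'| + `|t - t'|) &
        \forall x \near x0,
          Omega x <-> y x (inord 2) < zeta (y x (inord 0)) (y x (inord 1))].

(* The surface measure on a Lipschitz boundary is the two-dimensional Hausdorff
   measure, normalised by pi/4 so as to agree with area on planes. *)
Definition ediam (R : realType) (A : set (R3 R)) : \bar R :=
  ereal_sup [set z | z = 0%E \/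
    exists x y, [/\ A x, A y & z = (enorm (x - y))%:E]].

Definition area_gauge (R : realType) (A : set (R3 R)) : \bar R :=
  ((pi / 4)%:E * (ediam A * ediam A))%E.

Definition hausdorff2_pre (R : realType) (delta : R) (A : set (R3 R)) : \bar R :=
  ereal_inf [set (\sum_(k <oo) area_gauge (F k))%E | F in
    [set F : (set (R3 R))^nat |
      (forall k, ediam (F k) <= delta%:E)%E /\ A `<=` \bigcup_k F k]].

Definition hausdorff2 (R : realType) (A : set (R3 R)) : \bar R :=
  ereal_sup [set hausdorff2_pre delta A | delta in [set delta : R | 0 < delta]].

Lemma ediam_ge0 (R : realType) (A : set (R3 R)) : (0 <= ediam A)%E.
Proof. by apply: ereal_sup_ubound; left. Qed.

Lemma ediam0 (R : realType) : ediam (@set0 (R3 R)) = 0%E.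
Proof.
apply/eqP; rewrite eq_le ediam_ge0 andbT; apply: ge_ereal_sup.
by move=> z [->//|[x [y []]]].
Qed.

Lemma area_gauge_ge0 (R : realType) (A : set (R3 R)) : (0 <= area_gauge A)%E.
Proof.
rewrite /area_gauge mule_ge0// ?mule_ge0 ?ediam_ge0//.
by rewrite lee_fin divr_ge0// pi_ge0.
Qed.

Lemma area_gauge0 (R : realType) : area_gauge (@set0 (R3 R)) = 0%E.
Proof. by rewrite /area_gauge ediam0 mule0 mule0. Qed.

Lemma hausdorff2_pre_ge0 (R : realType) (delta : R) (A : set (R3 R)) :
  (0 <= hausdorff2_pre delta A)%E.
Proof.
apply: le_ereal_inf_tmp => x [B _ <-]; apply: nneseries_ge0 => n _ _.
exact: area_gauge_ge0.
Qed.

Lemma hausdorff2_pre_subadditive (R : realType) (delta : R) : 0 < delta ->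
  sigma_subadditive (@hausdorff2_pre R delta).
Proof.
move=> d0; set mu := (@hausdorff2_pre R delta) => A.
have [[i ioo]|] := pselect (exists i, mu (A i) = +oo%E).
  rewrite (eseries_pinfty _ _ ioo) ?leey// => n _.
  by rewrite -ltNye (lt_le_trans _ (hausdorff2_pre_ge0 _ _)).
rewrite -forallNE => Aoo.
suff add2e (e : {posnum R}) :
    (mu (\bigcup_n A n) <= \sum_(i <oo) mu (A i) + e%:num%:E)%E.
  by apply/lee_addgt0Pr => _/posnumP[].
rewrite (le_trans _ (epsilon_trick _ _ _))//; last first.
  by move=> n; exact: hausdorff2_pre_ge0.
pose P n (B : (set (R3 R))^nat) :=
  ((forall k, ediam (B k) <= delta%:E)%E /\ A n `<=` \bigcup_k B k) /\
  (\sum_(k <oo) area_gauge (B k) <= mu (A n) + (e%:num / (2 ^ n.+1)%:R)%:E)%E.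
have [G PG] : {G : ((set (R3 R))^nat)^nat & forall n, P n (G n)}.
  apply: (@choice _ _ P) => n; rewrite /P /mu /hausdorff2_pre.
  set S := (X in ereal_inf X); move infS : (ereal_inf S) => iS.
  case: iS infS => [r Sr|Soo|Soo].
  - have en1 : 0 < e%:num / (2 ^ n.+1)%:R by [].
    have /(lb_ereal_inf_adherent en1) : ereal_inf S \is a fin_num by rewrite Sr.
    move=> [x [B mB muBx] xS].
    by exists B; split => //; rewrite muBx -Sr; exact/ltW.
  - by have := Aoo n; rewrite /mu /hausdorff2_pre Soo.
  - suff : lbound S 0%E by move/le_ereal_inf_tmp; rewrite Soo.
    move=> /= _ [B _ <-]; apply: nneseries_ge0 => k _ _.
    exact: area_gauge_ge0.
have muG_ge0 x : (0 <= (@area_gauge R \o uncurry G) x)%E.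
  exact: area_gauge_ge0.
apply: (@le_trans _ _ (\esum_(i in setT) (@area_gauge R \o uncurry G) i)).
  apply: ereal_inf_lbound => /=.
  have /card_esym/ppcard_eqP[f] := card_nat2.
  exists (uncurry G \o f).
    split => [i|]; first by rewrite /=; case: (f i) => a b; exact: (PG a).1.1.
    apply: (@subset_trans _  (\bigcup_n \bigcup_k G n k)) => [t [i _]|].
      by move=> /((PG i).1.2) -[j _ ?]; exists i => //; exists j.
    move=> t [i _ [j _ Bijt]]; exists (f^-1%FUN (i, j)) => //=.
    by rewrite invK ?inE.
  rewrite -(esum_pred_image (@area_gauge R \o uncurry G) _ xpredT) ?[fun=> _]set_true//.
  by rewrite image_eq.
rewrite (_ : esum _ _ = (\sum_(i <oo) \sum_(j <oo) area_gauge (G i j))%E); last first.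
  pose J : nat -> set (nat * nat) := fun i => [set (i, j) | j in setT].
  rewrite (_ : setT = \bigcup_k J k); last first.
    by rewrite predeqE => -[a b]; split => // _; exists a => //; exists b.
  rewrite esum_bigcupT /=; last 2 first.
    - apply/trivIsetP => i j _ _ ij.
      rewrite predeqE => -[n m] /=; split => //= -[] [_] _ [<-{n} _].
      by move=> [m' _] [] /esym/eqP; rewrite (negbTE ij).
    - by move=> /= [n m]; exact: area_gauge_ge0.
  rewrite -(image_id [set: nat]) -fun_true esum_pred_image//; last first.
    by move=> n _; apply: esum_ge0 => ? _; exact: area_gauge_ge0.
  apply: eq_eseriesr => /= j _.
  rewrite -(esum_pred_image (@area_gauge R \o uncurry G) (pair j) predT)//=; last 2 first.
    - by move=> ? _; exact: area_gauge_ge0.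
    - by move=> ? ? _ _ [].
  by congr esum; rewrite predeqE => -[a b]; split; move=> [i _ <-]; exists i.
apply: lee_lim.
- apply: is_cvg_nneseries => n *.
  by apply: nneseries_ge0 => m *; exact: (muG_ge0 (n, m)).
- by apply: is_cvg_nneseries => n *; apply: adde_ge0 => //; exact: hausdorff2_pre_ge0.
- by near=> n; apply: lee_sum => i _; exact: (PG i).2.
Unshelve. all: by end_near. Qed.

Lemma hausdorff2_ge0 (R : realType) (A : set (R3 R)) : (0 <= hausdorff2 A)%E.
Proof.
apply: (le_trans (hausdorff2_pre_ge0 1 A)); apply: ereal_sup_ubound.
by exists 1 => //=; exact: ltr01.
Qed.

Lemma hausdorff2_set0 (R : realType) : hausdorff2 (@set0 (R3 R)) = 0%E.
Proof.
apply/eqP; rewrite eq_le hausdorff2_ge0 andbT; apply: ge_ereal_sup.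
move=> _ [delta /= d0 <-]; apply: ereal_inf_lbound; exists (fun=> set0).
  by split=> // k; rewrite ediam0 lee_fin ltW.
by rewrite eseries0// => k _ _; rewrite area_gauge0.
Qed.

Lemma le_hausdorff2 (R : realType) :
  {homo (@hausdorff2 R) : A B / A `<=` B >-> (A <= B)%E}.
Proof.
move=> A B AB; apply: ge_ereal_sup => _ [delta /= d0 <-].
apply: (@le_trans _ _ (hausdorff2_pre delta B)); last first.
  by apply: ereal_sup_ubound; exists delta.
apply/ereal_inf_le_tmp => x [F [dF BF] <-]; exists F => //; split => //.
exact: subset_trans AB BF.
Qed.

Lemma hausdorff2_subadditive (R : realType) : sigma_subadditive (@hausdorff2 R).
Proof.
move=> A; apply: ge_ereal_sup => _ [delta /= d0 <-].
apply: (le_trans (hausdorff2_pre_subadditive d0 A)).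
apply: lee_nneseries => [n _ _|n _]; first exact: hausdorff2_pre_ge0.
by apply: ereal_sup_ubound; exists delta.
Qed.

HB.instance Definition _ (R : realType) :=
  isOuterMeasure.Build R (R3 R) (@hausdorff2 R) (@hausdorff2_set0 R)
    (@hausdorff2_ge0 R) (@le_hausdorff2 R) (@hausdorff2_subadditive R).

Definition hausdorff2_outer (R : realType) :
  {outer_measure set (R3 R) -> \bar R} := @hausdorff2 R.

Definition surface (R : realType) :
    {measure set (caratheodory_type (hausdorff2_outer R)) -> \bar R} :=
  hausdorff2_outer R.

(* Complex-valued functions and L^2 spaces; functions stand for their classes
   modulo almost everywhere equality. *)
Definition cintegral d (T : measurableType d) (R : realType)
    (mu : {measure set T -> \bar R}) (D : set T) (f : T -> R[i]) : R[i] :=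
  (\int[mu]_(x in D) complex.Re (f x)) +i* (\int[mu]_(x in D) complex.Im (f x)).

Definition sqabs (R : realType) (z : R[i]) : R :=
  complex.Re z ^+ 2 + complex.Im z ^+ 2.

Definition sqL2norm d (T : measurableType d) (R : realType)
    (mu : {measure set T -> \bar R}) (D : set T) (f : T -> R[i]) : \bar R :=
  (\int[mu]_(x in D) (sqabs (f x))%:E)%E.

Definition inL2 d (T : measurableType d) (R : realType)
    (mu : {measure set T -> \bar R}) (D : set T) (f : T -> R[i]) : Prop :=
  [/\ measurable_fun D (fun x => complex.Re (f x)),
      measurable_fun D (fun x => complex.Im (f x)) &
      (sqL2norm mu D f < +oo)%E].

Definition innerL2 d (T : measurableType d) (R : realType)
    (mu : {measure set T -> \bar R}) (D : set T) (f g : T -> R[i]) : R[i] :=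
  cintegral mu D (fun x => f x * conjc (g x)).

Definition innerL2v d (T : measurableType d) (R : realType)
    (mu : {measure set T -> \bar R}) (D : set T) (F G : 'I_3 -> T -> R[i]) : R[i] :=
  \sum_(i < 3) innerL2 mu D (F i) (G i).

Definition inLinfty (R : realType) (D : set (R3 R)) (f : R3 R -> R) : Prop :=
  measurable_fun D f /\
  exists M : R, {ae vol R, forall x, D x -> `|f x| <= M}.

(* The support in R^3 of (the extension by zero of) f : D -> R, understood
   modulo null sets. *)
Definition ess_support (R : realType) (D : set (R3 R)) (f : R3 R -> R) :
    set (R3 R) :=
  [set x | forall U, nbhs x U ->
     ~ (vol R).-negligible (U `&` D `&` [set y | f y != 0])].

(* Smooth functions, test functions, weak gradients and H^1. *)
Definition pderiv (R : realType) (i : 'I_3) (f : R3 R -> R) : R3 R -> R :=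
  fun x => 'D_(basis R i) f x.

Fixpoint Cn (R : realType) (n : nat) (f : R3 R -> R) : Prop :=
  continuous f /\
  (if n is m.+1 then
     forall i, (forall x, derivable f x (basis R i)) /\ Cn m (pderiv i f)
   else True).

Definition test_function (R : realType) (D : set (R3 R)) (f : R3 R -> R) : Prop :=
  let S := closure [set x | f x != 0] in
  [/\ forall n, Cn n f, compact S & S `<=` D].

Definition ctest_function (R : realType) (D : set (R3 R)) (f : R3 R -> R[i]) : Prop :=
  test_function D (fun x => complex.Re (f x)) /\
  test_function D (fun x => complex.Im (f x)).

Definition cgrad (R : realType) (f : R3 R -> R[i]) : 'I_3 -> R3 R -> R[i] :=
  fun i x => pderiv i (fun y => complex.Re (f y)) x +i*
             pderiv i (fun y => complex.Im (f y)) x.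

Definition laplacian (R : realType) (f : R3 R -> R) : R3 R -> R :=
  fun x => \sum_(i < 3) pderiv i (pderiv i f) x.

Definition weak_gradient (R : realType) (D : set (R3 R)) (u : R3 R -> R[i])
    (Du : 'I_3 -> R3 R -> R[i]) : Prop :=
  forall psi, test_function D psi -> forall i,
    cintegral (vol R) D (fun x => u x * (pderiv i psi x)%:C) =
    - cintegral (vol R) D (fun x => Du i x * (psi x)%:C).

(* u is in H^1(D), with gradient Du. *)
Definition inH1 (R : realType) (D : set (R3 R)) (u : R3 R -> R[i])
    (Du : 'I_3 -> R3 R -> R[i]) : Prop :=
  [/\ inL2 (vol R) D u, forall i, inL2 (vol R) D (Du i) & weak_gradient D u Du].

Definition sqH1norm (R : realType) (D : set (R3 R)) (u : R3 R -> R[i])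
    (Du : 'I_3 -> R3 R -> R[i]) : \bar R :=
  (sqL2norm (vol R) D u + \sum_(i < 3) sqL2norm (vol R) D (Du i))%E.

(* Graph of the trace operator H^1(D) -> L^2(S), for S a part of the boundary
   of D: the closure of the restriction map on C_c^oo(R^3). *)
Definition has_trace (R : realType) (D S : set (R3 R)) (u phi : R3 R -> R[i]) :
    Prop :=
  inL2 (surface R) S phi /\
  exists Du, inH1 D u Du /\
  exists w : nat -> R3 R -> R[i],
    [/\ forall n, ctest_function setT (w n),
        (fun n => sqH1norm D (fun x => w n x - u x)
                             (fun i x => cgrad (w n) i x - Du i x)) @ \oo
          --> 0%E &
        (fun n => sqL2norm (surface R) S (fun x => w n x - phi x)) @ \oo
          --> 0%E].

Definition int_trace (R : realType) (Omega : set (R3 R)) (u phi : R3 R -> R[i]) :=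
  has_trace Omega (boundary Omega) u phi.

(* Trace on the boundary of Omega from the exterior, for functions which are
   H^1 near the boundary only. *)
Definition ext_trace (R : realType) (Omega : set (R3 R)) (v phi : R3 R -> R[i]) :=
  forall rho, closure Omega `<=` eball rho ->
    has_trace (exterior Omega `&` eball rho) (boundary Omega) v phi.

(* H^{1/2} of the boundary is the range of the trace operator. *)
Definition inH12 (R : realType) (Omega : set (R3 R)) (phi : R3 R -> R[i]) : Prop :=
  exists u, int_trace Omega u phi.

(* H^1_loc in the exterior domain, up to the boundary. *)
Definition inH1loc_ext (R : realType) (Omega : set (R3 R)) (v : R3 R -> R[i])
    (Dv : 'I_3 -> R3 R -> R[i]) : Prop :=
  forall rho, inH1 (exterior Omega `&` eball rho) v Dv.

Definition radial_deriv (R : realType) (v : R3 R -> R[i]) (x : R3 R) : R[i] :=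
  let e := (enorm x)^-1 *: x in
  'D_e (fun y => complex.Re (v y)) x +i* 'D_e (fun y => complex.Im (v y)) x.

(* The limit is uniform in the direction x / |x|. *)
Definition sommerfeld (R : realType) (k : R) (v : R3 R -> R[i]) : Prop :=
  forall eps : R, 0 < eps -> exists rho : R, forall x, rho < enorm x ->
    enorm x ^+ 2 * sqabs (radial_deriv v x - (0 +i* k) * v x) < eps ^+ 2.

(* v is the solution of the exterior Dirichlet problem with data phi, Dv its
   gradient.  The Helmholtz equation holds in the sense of distributions.  As
   the radiation condition is pointwise, v is taken to be a differentiable
   representative, which exists by interior regularity. *)
Definition exterior_solution (R : realType) (Omega : set (R3 R)) (k : R)
    (phi v : R3 R -> R[i]) (Dv : 'I_3 -> R3 R -> R[i]) : Prop :=
  [/\ inH1loc_ext Omega v Dv,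
      forall psi, test_function (exterior Omega) psi ->
        cintegral (vol R) (exterior Omega)
          (fun x => v x * (laplacian psi x + k ^+ 2 * psi x)%:C) = 0,
      forall x, exterior Omega x ->
        differentiable (fun y => complex.Re (v y)) x /\
        differentiable (fun y => complex.Im (v y)) x,
      ext_trace Omega v phi &
      sommerfeld k v].

(* lam is the functional psi |-> <Lambda_k phi, psi> on H^{1/2}.  The normal
   derivative of v in H^{-1/2}, for the normal pointing out of Omega, is
   defined by Green's formula in the exterior domain,
     <d_nu v, gamma w> = - <grad v, grad w> - <Delta v, w>
   for w in H^1 of the exterior with bounded support; here Delta v = - k^2 v. *)
Definition is_DtN (R : realType) (Omega : set (R3 R)) (k : R)
    (phi : R3 R -> R[i]) (lam : (R3 R -> R[i]) -> R[i]) : Prop :=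
  exists v Dv, exterior_solution Omega k phi v Dv /\
  forall w Dw psi, inH1 (exterior Omega) w Dw ->
    (exists rho, forall x, ~ eball rho x -> w x = 0 /\ forall i, Dw i x = 0) ->
    ext_trace Omega w psi ->
    lam psi = - innerL2v (vol R) (exterior Omega) Dv Dw
              + (k ^+ 2)%:C * innerL2 (vol R) (exterior Omega) v w.

(* u solves the Direct Problem at frequency k with source f; hk is h(k). *)
Definition direct_solution (R : realType) (Omega : set (R3 R)) (a b : R3 R -> R)
    (k : R) (hk : R[i]) (f u : R3 R -> R[i]) : Prop :=
  exists Du phi lam,
    [/\ inH1 Omega u Du, int_trace Omega u phi, is_DtN Omega k phi lam &
        forall v Dv psi, inH1 Omega v Dv -> int_trace Omega v psi ->
          innerL2v (vol R) Omega (fun i x => (a x)%:C * Du i x) Dv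
          - (k ^+ 2)%:C * innerL2 (vol R) Omega (fun x => (b x)%:C * u x) v
          - lam psi
          = hk * innerL2 (vol R) Omega f v].

Definition exterior_well_posed (R : realType) (Omega : set (R3 R)) (k : R) : Prop :=
  forall phi, inH12 Omega phi ->
    (exists v Dv, exterior_solution Omega k phi v Dv) /\
    (forall v Dv v' Dv', exterior_solution Omega k phi v Dv ->
       exterior_solution Omega k phi v' Dv' ->
       {ae vol R, forall x, exterior Omega x -> v x = v' x}).

Definition direct_well_posed (R : realType) (Omega : set (R3 R)) (a b : R3 R -> R)
    (k : R) (hk : R[i]) : Prop :=
  [/\ forall f, inL2 (vol R) Omega f ->
        exists u, direct_solution Omega a b k hk f u,
      forall f u u', inL2 (vol R) Omega f ->
        direct_solution Omega a b k hk f u ->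
        direct_solution Omega a b k hk f u' ->
        {ae vol R, forall x, Omega x -> u x = u' x} &
      exists C : R, forall f u Du, inL2 (vol R) Omega f ->
        direct_solution Omega a b k hk f u -> inH1 Omega u Du ->
        (sqH1norm Omega u Du <= C%:E * sqL2norm (vol R) Omega f)%E].

Definition non_radiating (R : realType) (Omega : set (R3 R)) (a b : R3 R -> R)
    (k : R) (hk : R[i]) (g : R3 R -> R[i]) : Prop :=
  exists u, direct_solution Omega a b k hk g u /\ int_trace Omega u (fun=> 0).

(* The sources f and f' produce the same boundary trace at frequency k. *)
Definition same_boundary_data (R : realType) (Omega : set (R3 R))
    (a b : R3 R -> R) (k : R) (hk : R[i]) (f f' : R3 R -> R[i]) : Prop :=
  exists u u' phi,
    [/\ direct_solution Omega a b k hk f u, direct_solution Omega a b k hk f' u',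
        int_trace Omega u phi & int_trace Omega u' phi].

(* Main.v *)
Require Import Defs.
From HB Require Import structures.
From mathcomp Require Import all_boot all_order all_algebra.
From mathcomp Require Import complex.
From mathcomp Require Import all_classical all_reals all_analysis.
From mathcomp Require Import measurable_realfun lra ring.

Set Implicit Arguments.
Unset Strict Implicit.
Unset Printing Implicit Defensive.

Import Order.TTheory GRing.Theory Num.Theory numFieldNormedType.Exports.

Local Open Scope classical_set_scope.
Local Open Scope complex_scope.
Local Open Scope ring_scope.

(* The essential supports of 1 - a and 1 - b miss the boundary of Omega, so near
   a boundary point there is a closed box K in Omega with a = b = 1 a.e. on K.
   Take a smooth bump w supported in K and put
   g = prod_j (- Laplacian - k_j^2) w.  At frequency k_j the solution of the
   Direct Problem with source g is h(k_j) times the same product with the j-th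
   factor removed: it is smooth with support in K, so its boundary terms vanish.
   Finally g <> 0 because each factor is injective on smooth functions supported
   in K: if (- Laplacian - k^2) f = 0, then h(k) f solves the Direct Problem with
   zero source, whence f = 0 by uniqueness. *)

(** * Volume in R^3 *)

(** A field that vanishes near the boundary makes the nonlocal part of the Direct Problem trivial:
    its trace is zero, the zero field solves the exterior problem, and zero serves as the
    Dirichlet-to-Neumann functional. What remains is that [v] ranges over all of H^1, without
    boundary condition; this is harmless because the weak gradient of [v] is only ever tested
    against derivatives of the smooth field, which are supported in [K]. Staying where a = b = 1
    serves two purposes. The factors have constant coefficients there, so they commute and the one
    belonging to k_j can be brought to the front; and smoothness survives any number of factors,
    although [a] and [b] are merely bounded. Injectivity of a factor is read off from the assumed
    uniqueness, which replaces an argument by unique continuation or Fourier transform. Fields stay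
    real until the final multiplication by h(k), so that most of the calculus is done for real
    functions. *)

Definition box (R : realType) (c : R3 R) (r : R) : set (R3 R) :=
  ball c.1.1 r `*` ball c.1.2 r `*` ball c.2 r.

Lemma ball_box (R : realType) (c : R3 R) (r : R) : ball c r = box c r.
Proof. by []. Qed.

(** Rational centres and radii make the union countable, which links the product topology to the
    product sigma-algebra. *)
Lemma open_box_bigcup (R : realType) (A : set (R3 R)) : open A ->
  A = \bigcup_(q in [set q : rat * rat * rat * rat |
        box (ratr q.1.1.1, ratr q.1.1.2, ratr q.1.2) (ratr q.2) `<=` A])
      box (ratr q.1.1.1, ratr q.1.1.2, ratr q.1.2) (ratr q.2).
Proof.
move=> oA; apply/seteqP; split; last by move=> x [q qA]; exact: qA.
move=> x Ax; have /nbhs_ballP[e /= e0 xeA] := open_nbhs_nbhs (conj oA Ax).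
(* The rational centre will lie within e / 4 of [x]. A radius above e / 4 keeps [x] in the box, and
   one below e / 2 keeps the box in the ball of radius [e]. *)
have [|r] := @rat_in_itvoo R (e / 4) (e / 2); first lra.
rewrite in_itv/= => /andP[er re].
have rat_close (y : R) : exists q : rat, `|ratr q - y| < e / 4.
  have [|q] := @rat_in_itvoo R (y - e / 4) (y + e / 4); first lra.
  rewrite in_itv/= => /andP[q1 q2]; exists q.
  by rewrite ltr_distlC; apply/andP; split; lra.
have [q1 q1x] := rat_close x.1.1.
have [q2 q2x] := rat_close x.1.2.
have [q3 q3x] := rat_close x.2.
exists (q1, q2, q3, r) => /=.
  have tr (s t u : R) : `|s - t| < e / 4 -> `|s - u| < ratr r -> `|t - u| < e.
    move=> st su; rewrite (_ : t - u = (s - u) - (s - t)); last by ring.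
    by rewrite (le_lt_trans (ler_normB _ _))//; lra.
  by move=> y [[/= y1 y2] y3]; apply: xeA; split; [split|];
    [exact: tr y1|exact: tr y2|exact: tr y3].
by split; [split|]; rewrite /ball/=; lra.
Qed.

Lemma measurable_ball1 (R : realType) (a r : R) : measurable (ball a r).
Proof.
have [r0|r0] := ltP 0 r; first by apply: open_measurable; exact: ball_open.
by rewrite (ball0 _ _).2.
Qed.

Lemma measurable_box (R : realType) (c : R3 R) (r : R) :
  measurable (box c r : set (mR3 R)).
Proof.
by apply: measurableX; [apply: measurableX|]; exact: measurable_ball1.
Qed.

Lemma open_measurable3 (R : realType) (A : set (R3 R)) :
  open A -> measurable (A : set (mR3 R)).
Proof.
move/open_box_bigcup ->; rewrite bigcup_mkcond.
apply: countable_bigcupT_measurable => // q.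
by case: ifP => // _; exact: measurable_box.
Qed.

Lemma continuous_measurable3 (R : realType) (f : R3 R -> R) (D : set (mR3 R)) :
  measurable D -> continuous f -> measurable_fun D (f : mR3 R -> R).
Proof.
move=> mD /continuousP cf; apply: (measurability _ (RGenOpens.measurableE R)).
move=> _ [_ [a [b ->] <-]]; apply: measurableI => //.
by apply: open_measurable3; apply: cf; exact: interval_open.
Qed.

Lemma vol_box (R : realType) (c : R3 R) (r : R) : 0 <= r ->
  vol R (box c r) = ((r *+ 2) ^+ 3)%:E.
Proof.
move=> r0; have mb (a : R) : measurable (ball a r : set (measurableTypeR R)).
  by exact: measurable_ball1.
rewrite /vol/= product_measure1E//=; last exact: measurableX.
rewrite (product_measure1E lebesgue_measure)//=.
by rewrite !lebesgue_measure_ball// -!EFinM !exprS expr0 mulr1 mulrA.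
Qed.

Lemma vol_open_gt0 (R : realType) (A : set (R3 R)) :
  open A -> A !=set0 -> (0 < vol R A)%E.
Proof.
move=> oA [x Ax]; have /nbhs_ballP[e /= e0 xeA] := open_nbhs_nbhs (conj oA Ax).
apply: (@lt_le_trans _ _ (vol R (box x e))).
  by rewrite vol_box ?ltW// lte_fin exprn_gt0// pmulrn_lgt0.
by apply: le_measure => //; rewrite inE;
  [exact: measurable_box|exact: open_measurable3].
Qed.

Lemma bounded_sub_box (R : realType) (A : set (R3 R)) : bounded_set A ->
  exists2 M : R, 0 < M & A `<=` box 0 M.
Proof.
move=> [M [_ AM]]; have MM := ler_norm M; exists (`|M| + 2).
  by rewrite ltr_wpDl.
move=> x Ax; have /= xM := AM (`|M| + 1) ltac:(lra) x Ax.
rewrite -[box _ _]ball_box -ball_normE /= sub0r normrN.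
by rewrite (le_lt_trans xM)//; lra.
Qed.

Lemma vol_bounded (R : realType) (A : set (R3 R)) :
  open A -> bounded_set A -> (vol R A < +oo)%E.
Proof.
move=> oA /bounded_sub_box[M M0 AM].
apply: (@le_lt_trans _ _ (vol R (box 0 M))).
  by apply: le_measure => //; rewrite inE;
    [exact: open_measurable3|exact: measurable_box].
by rewrite vol_box ?ltW// ltry.
Qed.

(** * Bump functions *)

(** The classical flat function exp(-1/t), with a power t^(-n) in front so that the span of the
    family is closed under differentiation. *)
Definition flat (R : realType) (n : nat) (t : R) : R :=
  if 0 < t then t^-1 ^+ n * expR (- t^-1) else 0.

Definition dflat (R : realType) (n : nat) (t : R) : R :=
  flat n.+2 t - n%:R * flat n.+1 t.

(** A single term of the exponential series bounds exp(y) from below. *)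
Lemma exprn_expRN_le (R : realType) (n : nat) (y : R) : 0 <= y ->
  y ^+ n.+1 * expR (- y) <= n.+1`!%:R.
Proof.
move=> y0; rewrite expRN ler_pdivrMr ?expR_gt0//.
have := expR_ge1Dxn n y0; have : 0 < n.+1`!%:R :> R by rewrite ltr0n fact_gt0.
move: (n.+1`!%:R) => c c0 h; rewrite -ler_pdivrMl// mulrC; lra.
Qed.

(** The previous bound at y = 1/t with two spare powers of [y]. Quadratic decay is what makes the
    difference quotient at 0 tend to 0. *)
Lemma flat_quadratic (R : realType) (n : nat) (t : R) :
  `|flat n t| <= n.+2`!%:R * t ^+ 2.
Proof.
rewrite /flat; case: ifPn => t0; last by rewrite normr0 mulr_ge0// sqr_ge0.
have t1 : 0 <= t^-1 by rewrite invr_ge0 ltW.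
rewrite ger0_norm ?mulr_ge0 ?expR_ge0 ?exprn_ge0//.
rewrite -ler_pdivrMr ?exprn_gt0// mulrAC -exprVn -exprD addn2.
exact: exprn_expRN_le.
Qed.

Lemma is_derive_flat (R : realType) (n : nat) (t : R) :
  is_derive t 1 (flat n) (dflat n t).
Proof.
have [t0|t0|->] := ltgtP t 0.
- have -> : dflat n t = 0 by rewrite /dflat /flat ltNge ltW//= mulr0 subr0.
  apply: (@near_eq_is_derive _ R R (cst 0)).
  near=> s; rewrite /flat ifF//=; apply/negbTE; rewrite -leNgt.
  by rewrite ltW//; near: s; exact: lt_nbhsl.
- apply: (@near_eq_is_derive _ R R (fun s => s^-1 ^+ n * expR (- s^-1))).
    near=> s; rewrite /flat ifT//; near: s; exact: lt_nbhsr.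
  have t1 : t != 0 by rewrite gt_eqF.
  have dV : is_derive t 1 (fun s : R => s^-1) (- t ^- 2).
    by apply: is_derive_eq; [exact: is_deriveV|rewrite /= scaler1].
  have dX : is_derive t 1 (fun s : R => s^-1 ^+ n)
      ((n%:R * t^-1 ^+ n.-1) *: - t ^- 2).
    rewrite (_ : (fun s : R => _) = (fun s : R => s^-1) ^+ n).
      exact: is_deriveX.
    by apply/funext => s; rewrite exprfctE.
  have dN := is_deriveN dV.
  have dE : is_derive t 1 (fun s : R => expR (- s^-1))
      (expR (- t^-1) * - - t ^- 2).
    exact: (is_derive1_comp (is_derive_expR _) dN).
  have dM := is_deriveM dX dE. apply: (is_derive_eq dM).
  rewrite /dflat /flat t0 /= opprK.
  rewrite /GRing.scale/= -!exprVn; set u := t^-1; set e := expR _.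
  (* The case split removes the [n.-1] left by the power rule; for n = 0 its coefficient
     vanishes. *)
  by clear dX dM; case: n => [|n] /=; rewrite !exprS ?expr0; ring.
- have d0 : dflat n 0 = 0 :> R by rewrite /dflat /flat ltxx mulr0 subr0.
  rewrite d0.
  (* At 0 no formula is available on both sides, so the limit is taken by hand: the quotient is at
     most (n+2)! |h|. *)
  have dl : (fun h => h^-1 *: (((@flat R n) \o shift 0) (h *: 1) - flat n 0))
      @ 0^' --> (0 : R).
    apply/cvgrPdist_le => e e0; near=> h.
    rewrite /= addr0 sub0r normrN {2}/flat ltxx subr0 /GRing.scale/= mulr1.
    rewrite normrM normfV.
    have h0 : h != 0 by near: h; exact: nbhs_dnbhs_neq.
    rewrite ler_pdivrMl ?normr_gt0//; apply: (le_trans (flat_quadratic n h)).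
    rewrite -real_normK ?num_real// expr2 mulrA [leRHS]mulrC.
    rewrite ler_pM2r ?normr_gt0//.
    rewrite mulrC -ler_pdivlMr ?ltr0n ?fact_gt0//.
    by near: h; apply: dnbhs0_le; rewrite divr_gt0// ltr0n fact_gt0.
  apply: DeriveDef; last exact: (cvg_lim _ dl).
  by apply/cvg_ex; exists 0.
Unshelve. all: by end_near. Qed.

(** * Smooth functions and smooth functions vanishing off a fixed set *)

Definition smooth (R : realType) (f : R3 R -> R) := forall n, Cn n f.

Lemma Cn_continuous (R : realType) n (f : R3 R -> R) : Cn n f -> continuous f.
Proof. by case: n => [|n] []. Qed.

Lemma CnW (R : realType) n (f : R3 R -> R) : Cn n.+1 f -> Cn n f.
Proof.
elim: n f => [|n IH] f; first by case.
by move=> [cf df]; split => // i; have [? /IH] := df i.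
Qed.

Lemma CnS_derivable (R : realType) n (f : R3 R -> R) i x :
  Cn n.+1 f -> derivable f x (Defs.basis R i).
Proof. by move=> [_ /(_ i)[]]. Qed.

Lemma CnS_pderiv (R : realType) n (f : R3 R -> R) i :
  Cn n.+1 f -> Cn n (pderiv i f).
Proof. by move=> [_ /(_ i)[]]. Qed.

Lemma pderivE (R : realType) i (f f' : R3 R -> R) :
  (forall x, is_derive x (Defs.basis R i) f (f' x)) -> pderiv i f = f'.
Proof. by move=> df; apply/funext => x; rewrite /pderiv derive_val. Qed.

Lemma pderivD (R : realType) i (f g : R3 R -> R) : Cn 1 f -> Cn 1 g ->
  pderiv i (fun x => f x + g x) = fun x => pderiv i f x + pderiv i g x.
Proof.
move=> cf cg; apply: pderivE => x.
have df : is_derive x (Defs.basis R i) f (pderiv i f x) :=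
  derivableP (CnS_derivable cf).
have dg : is_derive x (Defs.basis R i) g (pderiv i g x) :=
  derivableP (CnS_derivable cg).
exact: is_deriveD.
Qed.

Lemma pderivZ (R : realType) i c (f : R3 R -> R) : Cn 1 f ->
  pderiv i (fun x => c * f x) = fun x => c * pderiv i f x.
Proof.
move=> cf; apply: pderivE => x.
have df : is_derive x (Defs.basis R i) f (pderiv i f x) :=
  derivableP (CnS_derivable cf).
exact: is_deriveZ.
Qed.

Lemma pderivM (R : realType) i (f g : R3 R -> R) : Cn 1 f -> Cn 1 g ->
  pderiv i (fun x => f x * g x) =
  fun x => f x * pderiv i g x + g x * pderiv i f x.
Proof.
move=> cf cg; apply: pderivE => x.
have df : is_derive x (Defs.basis R i) f (pderiv i f x) :=
  derivableP (CnS_derivable cf).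
have dg : is_derive x (Defs.basis R i) g (pderiv i g x) :=
  derivableP (CnS_derivable cg).
exact: is_deriveM.
Qed.

Lemma pderiv_cst (R : realType) i (c : R) :
  pderiv i (fun _ : R3 R => c) = fun=> 0.
Proof. by apply: pderivE => x; exact: is_derive_cst. Qed.

Lemma Cn1 (R : realType) n (f : R3 R -> R) : Cn n.+1 f -> Cn 1 f.
Proof. by elim: n => // n IH /CnW. Qed.

Lemma Cn_cst (R : realType) n (c : R) : Cn n (fun _ : R3 R => c).
Proof.
elim: n c => [|n IH] c; split => //; try exact: cst_continuous.
move=> i; split=> [x|]; first exact: derivable_cst.
by rewrite pderiv_cst.
Qed.

Lemma CnD (R : realType) n (f g : R3 R -> R) :
  Cn n f -> Cn n g -> Cn n (fun x => f x + g x).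
Proof.
elim: n f g => [|n IH] f g cf cg.
  by split => // x; apply: continuousD; [exact: cf.1|exact: cg.1].
split => [x|i]; first by apply: continuousD; [exact: cf.1|exact: cg.1].
split=> [x|].
  apply: (@derivableD _ _ _ f g).
    exact: CnS_derivable cf.
  exact: CnS_derivable cg.
rewrite pderivD; [|exact: Cn1 cf|exact: Cn1 cg].
by apply: IH; exact: CnS_pderiv.
Qed.

Lemma CnM (R : realType) n (f g : R3 R -> R) :
  Cn n f -> Cn n g -> Cn n (fun x => f x * g x).
Proof.
elim: n f g => [|n IH] f g cf cg.
  by split => // x; apply: continuousM; [exact: cf.1|exact: cg.1].
split => [x|i]; first by apply: continuousM; [exact: cf.1|exact: cg.1].
split=> [x|].
  apply: (@derivableM _ _ f g).
    exact: CnS_derivable cf.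
  exact: CnS_derivable cg.
rewrite pderivM; [|exact: Cn1 cf|exact: Cn1 cg].
by apply: CnD; apply: IH; try exact: CnS_pderiv; exact: CnW.
Qed.

Lemma CnZ (R : realType) n c (f : R3 R -> R) :
  Cn n f -> Cn n (fun x => c * f x).
Proof. by move=> cf; apply: CnM => //; exact: Cn_cst. Qed.

(** Fixing [K] once, instead of following the support of each function, makes the class a vector
    space that is stable under differentiation and under products with smooth functions. *)
Definition smooth_off (R : realType) (K : set (R3 R)) (f : R3 R -> R) :=
  smooth f /\ forall x, ~ K x -> f x = 0.

Section smooth_off.
Variables (R : realType) (K : set (R3 R)).
Implicit Types f g : R3 R -> R.

Lemma smooth_off0 : smooth_off K (fun=> 0).
Proof. by split => // n; exact: Cn_cst. Qed.

Lemma smooth_offD f g : smooth_off K f -> smooth_off K g ->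
  smooth_off K (fun x => f x + g x).
Proof.
move=> [cf f0] [cg g0]; split=> [n|x Kx]; first exact: CnD.
by rewrite f0// g0// addr0.
Qed.

Lemma smooth_offM f g : smooth_off K f -> smooth g ->
  smooth_off K (fun x => f x * g x).
Proof.
move=> [cf f0] cg; split=> [n|x Kx]; first exact: CnM.
by rewrite f0// mul0r.
Qed.

Lemma smooth_offZ c f : smooth_off K f -> smooth_off K (fun x => c * f x).
Proof.
move=> [cf f0]; split=> [n|x Kx]; first exact: CnZ.
by rewrite f0// mulr0.
Qed.

(** The complement of [K] is open, so [f] vanishes near each of its points and not just at them. *)
Lemma smooth_off_pderiv i f : closed K -> smooth_off K f ->
  smooth_off K (pderiv i f).
Proof.
move=> cK [cf f0]; split=> [n|x Kx]; first exact: CnS_pderiv.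
rewrite -[RHS](derive_cst 0 x (Defs.basis R i)); apply: near_eq_derive.
have : nbhs x (~` K) by apply: open_nbhs_nbhs; split => //; exact: closed_openC.
by apply: filterS => y /f0.
Qed.

Lemma smooth_off_sum (I : Type) (r : seq I) (F : I -> R3 R -> R) :
  (forall i, smooth_off K (F i)) -> smooth_off K (fun x => \sum_(i <- r) F i x).
Proof.
move=> sF; elim: r => [|i r IH].
  by under eq_fun do rewrite big_nil; exact: smooth_off0.
by under eq_fun do rewrite big_cons; exact: smooth_offD.
Qed.

Lemma smooth_off_laplacian f : closed K -> smooth_off K f ->
  smooth_off K (laplacian f).
Proof.
move=> cK Kf; apply: smooth_off_sum => i.
by do 2 apply: smooth_off_pderiv => //.
Qed.

Lemma smooth_off_test (D : set (R3 R)) f : compact K -> closed K -> K `<=` D ->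
  smooth_off K f -> test_function D f.
Proof.
move=> cK clK KD [cf f0].
have fK : closure [set x | f x != 0] `<=` K.
  move: clK => /closure_id ->; apply: closure_subset => x /= fx.
  by apply: contrapT => /f0/eqP; exact/negP.
split => //; last exact: subset_trans KD.
by apply: subclosed_compact cK fK; exact: closed_closure.
Qed.

End smooth_off.

(** * A smooth bump supported in a closed box *)

Lemma derive_line (R : realType) (V : normedModType R) (f : V -> R) (x v : V) :
  'D_1 (fun h : R => f (h *: v + x)) 0 = 'D_v f x.
Proof.
rewrite /derive; set g1 := fun h => h^-1 *: _; set g2 := fun h => h^-1 *: _.
suff -> : g1 = g2 by [].
by rewrite funeqE /g1 /g2 => h /=; rewrite addr0 scale0r add0r [_%:A]mulr1.
Qed.

(** Passage to one variable, where the chain rule and the fundamental theorem of calculus can be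
    applied. *)
Lemma is_derive_line (R : realType) (V : normedModType R) (f : V -> R)
    (x v : V) (df : R) :
  is_derive (0 : R) (1 : R) (fun h : R => f (h *: v + x)) df <->
  is_derive x v f df.
Proof.
split=> -[d <-]; apply: DeriveDef; rewrite ?derive_line//.
  exact/derivable1P.
exact: (derivable1P _ _ _).1.
Qed.

Lemma coord_line (R : realType) (h : R) (i j : 'I_3) (x : R3 R) :
  Defs.coord (h *: Defs.basis R j + x) i = Defs.coord x i + h * (i == j)%:R.
Proof.
have -> : (i == j) = (j == i :> nat) by rewrite eq_sym.
by move: i => [[|[|[|//]]] ?]; rewrite /Defs.coord /= addrC.
Qed.

Lemma continuous_coord (R : realType) (i : 'I_3) :
  continuous (fun x : R3 R => Defs.coord x i).
Proof.
move=> x; rewrite /Defs.coord; move: i => [[|[|[|//]]] ?] /=.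
- exact: (continuous_comp cvg_fst cvg_fst).
- exact: (continuous_comp cvg_fst cvg_snd).
- exact: cvg_snd.
Qed.

Definition flat_coord (R : realType) (i : 'I_3) (s l : R) (n : nat)
  (x : R3 R) : R := flat n (s * Defs.coord x i + l).

Lemma is_derive_flat_coord (R : realType) (i j : 'I_3) (s l : R) (n : nat)
    (x : R3 R) :
  is_derive x (Defs.basis R j) (flat_coord i s l n)
    ((s * (i == j)%:R) *
     (flat_coord i s l n.+2 x + - n%:R * flat_coord i s l n.+1 x)).
Proof.
apply/is_derive_line.
have -> : (fun h : R => flat_coord i s l n (h *: Defs.basis R j + x)) =
    flat n \o (fun h : R => h * (s * (i == j)%:R) + (s * Defs.coord x i + l)).
  apply/funext => h; rewrite /flat_coord coord_line /=; congr flat; ring.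
have dl : is_derive (0 : R) (1 : R)
    (fun h : R => h * (s * (i == j)%:R) + (s * Defs.coord x i + l))
    (s * (i == j)%:R).
  have d1 := is_deriveD (is_deriveM (is_derive_id (0 : R) 1)
    (is_derive_cst (s * (i == j)%:R) (0 : R) 1))
    (is_derive_cst (s * Defs.coord x i + l) (0 : R) 1).
  by apply: (is_derive_eq d1); rewrite /GRing.scale /=; ring.
have df := is_derive_flat n (0 * (s * (i == j)%:R) + (s * Defs.coord x i + l)).
have dc := @is_derive1_comp _ _ (fun h : R => _) 0 _ _ df dl.
apply: (is_derive_eq dc).
by rewrite mul0r add0r mulrC mulNr.
Qed.

(** Each partial derivative is a combination of members of the same family with larger [n], so
    induction on the order works once [n] is generalised. *)
Lemma smooth_flat_coord (R : realType) (i : 'I_3) (s l : R) (n : nat) :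
  smooth (flat_coord i s l n).
Proof.
have cont m : continuous (flat_coord i s l m).
  move=> x; apply: (@continuous_comp _ _ _ (fun x => s * Defs.coord x i + l) (flat m)).
    apply: continuousD; last exact: cst_continuous.
    apply: continuousM; [exact: cst_continuous|exact: continuous_coord].
  apply/differentiable_continuous/derivable1_diffP.
  by have := is_derive_flat m (s * Defs.coord x i + l) => -[].
move=> N; elim: N n => [|N IH] n; split => // j.
split=> [x|]; first by have [] := is_derive_flat_coord i j s l n x.
rewrite (pderivE (is_derive_flat_coord i j s l n)).
by apply/CnZ/CnD => //; exact: CnZ.
Qed.

Definition closed_box (R : realType) (c : R3 R) (r : R) : set (R3 R) :=
  `[c.1.1 - r, c.1.1 + r]%classic `*` `[c.1.2 - r, c.1.2 + r]%classic `*`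
  `[c.2 - r, c.2 + r]%classic.

Lemma compact_closed_box (R : realType) (c : R3 R) (r : R) :
  compact (closed_box c r).
Proof.
by apply: compact_setX; [apply: compact_setX|]; exact: segment_compact.
Qed.

Lemma closed_box_coord (R : realType) (c : R3 R) (r : R) (x : R3 R) :
  closed_box c r x <->
  forall i, Defs.coord c i - r <= Defs.coord x i <= Defs.coord c i + r.
Proof.
split=> [[[/= x0 x1] x2] i|xc].
  by move: x0 x1 x2; rewrite !in_itv/= /Defs.coord; move: i => [[|[|[|//]]] ?].
by split; [split|]; rewrite /= in_itv/=;
 [exact: (xc ord0)|exact: (xc (@Ordinal 3 1 isT))|
  exact: (xc (@Ordinal 3 2 isT))].
Qed.

(** Writing t = x_i - c_i, the i-th factor is exp(-1/(r + t)) exp(-1/(r - t)), extended by zero; it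
    is nonzero exactly when |t| < r. *)
Definition box_bump (R : realType) (c : R3 R) (r : R) (x : R3 R) : R :=
  \prod_(i < 3) (flat_coord i 1 (r - Defs.coord c i) 0 x *
                 flat_coord i (- 1) (r + Defs.coord c i) 0 x).

Lemma flat_neq0 (R : realType) (n : nat) (t : R) : (flat n t != 0) = (0 < t).
Proof.
rewrite /flat; case: ifPn => t0; last by rewrite eqxx.
by rewrite gt_eqF// mulr_gt0 ?expR_gt0// exprn_gt0// invr_gt0.
Qed.

Lemma smooth_off_box_bump (R : realType) (c : R3 R) (r : R) :
  smooth_off (closed_box c r) (box_bump c r).
Proof.
split=> [n|x xc].
  have sb (i : 'I_3) : smooth (fun x => flat_coord i 1 (r - Defs.coord c i) 0 x *
      flat_coord i (- 1) (r + Defs.coord c i) 0 x).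
    by move=> m; apply: CnM; exact: smooth_flat_coord.
  rewrite /box_bump; elim: (index_enum _) => [|i s IH].
    by under eq_fun do rewrite big_nil; exact: Cn_cst.
  by under eq_fun do rewrite big_cons; apply: CnM => //; exact: sb.
apply/eqP; rewrite /box_bump; apply: contra_notT xc => /prodf_neq0 xc.
apply/closed_box_coord => i; have := xc i isT.
rewrite mulf_eq0 negb_or !flat_neq0 => /andP[h1 h2].
by apply/andP; split; lra.
Qed.

Lemma box_bump_neq0 (R : realType) (c : R3 R) (r : R) :
  0 < r -> box_bump c r c != 0.
Proof.
move=> r0; apply/prodf_neq0 => i _.
by rewrite mulf_eq0 negb_or !flat_neq0; apply/andP; split; lra.
Qed.

Lemma closed_box_sub (R : realType) (c : R3 R) (r r' : R) : r < r' ->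
  closed_box c r `<=` box c r'.
Proof.
move=> rr x [[/= x1 x2] x3]; move: x1 x2 x3; rewrite !in_itv/=.
move=> /andP[? ?] /andP[? ?] /andP[? ?].
by split; [split|]; rewrite /ball/= ltr_distlC; apply/andP; split; lra.
Qed.

(** * Integration by parts *)

Lemma integrable_bounded_support d (T : measurableType d) (R : realType)
    (mu : {measure set T -> \bar R}) (B : set T) (g : T -> R) (M : R) :
  measurable B -> (mu B < +oo)%E -> measurable_fun setT g ->
  (forall x, `|g x| <= M) -> (forall x, ~ B x -> g x = 0) ->
  mu.-integrable setT (EFin \o g).
Proof.
move=> mB Boo mg gM g0.
have -> : EFin \o g = (EFin \o g) \_ B.
  apply/funext => x; rewrite patchE; case: ifPn => //.
  by rewrite notin_setE => /g0 /= ->.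
apply: (integrable_mkcond _ mB).1; apply: measurable_bounded_integrable => //.
- exact: measurable_funTS.
- exists M; split; first exact: num_real.
  by move=> N MN x _ /=; rewrite (le_trans (gM x))// ltW.
Qed.

(** The integral reduces to [a, b], and [F] vanishes at both endpoints. *)
Lemma integral_derive_support (R : realType) (F F' : R -> R) (a b : R) :
  a < b -> continuous F' -> (forall t : R, is_derive t (1 : R) F (F' t)) ->
  (forall t, t <= a \/ b <= t -> F t = 0) ->
  (forall t, t < a \/ b < t -> F' t = 0) ->
  (\int[@lebesgue_measure R]_t (F' t)%:E = 0)%E.
Proof.
move=> ab cF' dF F0 F'0.
have -> : (fun t => (F' t)%:E) = (fun t => (F' t)%:E) \_ `[a, b].
  apply/funext => t; rewrite patchE; case: ifPn => //.
  rewrite notin_setE /= in_itv/= => /negP; rewrite negb_and -!ltNge => /orP tab.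
  by rewrite F'0//; move: tab => [].
have dF1 t : derivable F t 1 by have [] := dF t.
have cF : continuous F.
  by move=> t; exact/differentiable_continuous/derivable1_diffP.
rewrite -integral_mkcond (@continuous_FTC2 _ _ F)//.
- by rewrite !F0 ?lexx ?subee//; [left|right].
- exact: continuous_subspaceT.
- split => //.
  + exact/cvg_at_right_filter/cF.
  + exact/cvg_at_left_filter/cF.
- by move=> t _; rewrite derive1E derive_val.
Qed.

Lemma smooth_off_bounded (R : realType) (K : set (R3 R)) (f : R3 R -> R) :
  compact K -> smooth_off K f -> exists M, forall x, `|f x| <= M.
Proof.
move=> cK [cf f0].
have cfK : compact (f @` K).
  apply: continuous_compact => //; apply: continuous_subspaceT.
  exact: Cn_continuous (cf 0).
have [M [_ fM]] := compact_bounded cfK.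
exists (`|M| + 1) => x; have [Kx|/f0 ->] := pselect (K x); last first.
  by rewrite normr0 addr_ge0.
by apply: (fM (`|M| + 1)); [have := ler_norm M; lra|exists x].
Qed.

(* The library's sigma-finite instance on product measures is shadowed by the
   one for subprobabilities, whence this separate constant. *)
Definition area (R : realType) :
    set (measurableTypeR R * measurableTypeR R) -> \bar R :=
  (@lebesgue_measure R \x @lebesgue_measure R)%E.

HB.instance Definition _ (R : realType) := Measure.on (@area R).

Lemma area_square (R : realType) (r : R) : 0 <= r ->
  area (ball 0 r `*` ball 0 r) = ((r *+ 2) ^+ 2)%:E.
Proof.
move=> r0; rewrite /area (product_measure1E lebesgue_measure)//=;
  [|exact: measurable_ball1|exact: measurable_ball1].
by rewrite !lebesgue_measure_ball// -EFinM -expr2.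
Qed.

Lemma area_sigma_finite (R : realType) : sigma_finite setT (@area R).
Proof.
exists (fun n => ball 0 n%:R `*` ball 0 n%:R) => [|n]; last first.
  split; last by rewrite area_square// ltry.
  by apply: measurableX; exact: measurable_ball1.
apply/esym; rewrite -subTset => -[x y] _.
exists (Num.truncn (`|x| + `|y|)).+1 => //.
have := truncnS_gt (`|x| + `|y|); have := normr_ge0 x; have := normr_ge0 y.
by move=> ? ? ?; split; rewrite /ball/= sub0r normrN; lra.
Qed.

HB.instance Definition _ (R : realType) :=
  Measure_isSigmaFinite.Build _ _ R (@area R) (@area_sigma_finite R).

Section vol_Fubini.
Variable R : realType.
Local Open Scope ereal_scope.

Let m := @lebesgue_measure R.
Let mm := @area R.

Lemma vol_Fubini21 (g : mR3 R -> \bar R) : (vol R).-integrable setT g ->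
  \int[vol R]_x g x = \int[m]_z \int[mm]_xy g (xy, z).
Proof.
move=> intg.
by have <- := @integral21_prod_meas1 _ _ _ _ _ (@area R)
  (@lebesgue_measure R) g intg.
Qed.

Lemma vol_Fubini12 (g : mR3 R -> \bar R) : (vol R).-integrable setT g ->
  \int[vol R]_x g x = \int[mm]_xy \int[m]_z g (xy, z).
Proof.
move=> intg.
by have <- := @integral12_prod_meas1 _ _ _ _ _ (@area R)
  (@lebesgue_measure R) g intg.
Qed.

(** Fubini, in an order that integrates along direction [i] first. The integrability of the planar
    slices serves the second use of Fubini, in the first two coordinates. The line [F] is given by a
    pointwise equation so that each concrete parametrisation fits. *)
Lemma vol_integral_slice0 (g : mR3 R -> R) (i : 'I_3) :
  (vol R).-integrable setT (EFin \o g) ->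
  (forall z, mm.-integrable setT (fun xy => (g (xy, z))%:E)) ->
  (forall (F : R -> R3 R) x,
    (forall t, F t = (t - Defs.coord x i)%R *: Defs.basis R i + x)%R ->
    \int[m]_t (g (F t))%:E = 0) ->
  \int[vol R]_x (g x)%:E = 0.
Proof.
move=> intg int2 sl.
move: i sl => [[|[|[|//]]] ?] sl.
- rewrite (vol_Fubini21 intg); apply: integral0_eq => z _.
  have <- := @integral21_prod_meas1 _ _ _ _ _ (@lebesgue_measure R)
    (@lebesgue_measure R) _ (int2 z).
  apply: integral0_eq => y _.
  rewrite /fubini_G; apply: (sl (fun t => (t, y, z)) (0, y, z)%R) => t.
  rewrite /Defs.coord /= subr0.
  by congr (_, _, _); rewrite /= /GRing.scale /=; ring.
- rewrite (vol_Fubini21 intg); apply: integral0_eq => z _.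
  have <- := @integral12_prod_meas1 _ _ _ _ _ (@lebesgue_measure R)
    (@lebesgue_measure R) _ (int2 z).
  apply: integral0_eq => x _.
  rewrite /fubini_F; apply: (sl (fun t => (x, t, z)) (x, 0, z)%R) => t.
  rewrite /Defs.coord /= subr0.
  by congr (_, _, _); rewrite /= /GRing.scale /=; ring.
- rewrite (vol_Fubini12 intg); apply: integral0_eq => -[x y] _.
  rewrite /fubini_F; apply: (sl (fun t => (x, y, t)) (x, y, 0)%R) => t.
  rewrite /Defs.coord /= subr0.
  by congr (_, _, _); rewrite /= /GRing.scale /=; ring.
Qed.

End vol_Fubini.

Lemma integrable_smooth_off (R : realType) (K : set (R3 R)) (f : R3 R -> R) :
  compact K -> smooth_off K f ->
  (vol R).-integrable setT (EFin \o (f : mR3 R -> R)).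
Proof.
move=> cK Kf; have [M M0 KM] := bounded_sub_box (compact_bounded cK).
have [C fC] := smooth_off_bounded cK Kf.
apply: (@integrable_bounded_support _ (mR3 R) R (vol R) (box 0 M) f C) => //.
- exact: measurable_box.
- by rewrite vol_box ?ltW// ltry.
- by apply: continuous_measurable3 => //; exact: Cn_continuous (Kf.1 0%N).
- by move=> x xM; apply: Kf.2 => /KM.
Qed.

Section integral_pderiv.
Variables (R : realType) (K : set (R3 R)) (f : R3 R -> R) (i : 'I_3).
Hypothesis cK : compact K.
Hypothesis Kf : smooth_off K f.

Let m := @lebesgue_measure R.
Let g := pderiv i f.
Let cg : continuous g.
Proof. exact: Cn_continuous (CnS_pderiv i (Kf.1 1)). Qed.

Let mg : measurable_fun setT (g : mR3 R -> R).
Proof. exact: continuous_measurable3. Qed.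

Let Kg : smooth_off K g.
Proof. by apply: smooth_off_pderiv => //; exact: compact_closed. Qed.

(** The i-th coordinate of [F t] is [t] itself, so the line is outside the box, hence outside [K],
    as soon as |t| >= M; the one-variable statement then applies on [-M, M]. *)
Let slice (F : R -> R3 R) (x : R3 R) M :
  0 < M -> K `<=` box 0 M ->
  (forall t, F t = (t - Defs.coord x i) *: Defs.basis R i + x) ->
  (\int[m]_t (g (F t))%:E = 0)%E.
Proof.
move=> M0 KM FE.
have cF t : Defs.coord (F t) i = t by rewrite FE coord_line eqxx mulr1 subrKC.
have off t : t <= - M \/ M <= t -> ~ K (F t).
  move=> tM /KM; rewrite -[box _ _]ball_box => FM.
  have : `|t| < M.
    move: FM; rewrite ball_box -[X in `|X|]cF /Defs.coord => -[[]].
    rewrite /ball/= !sub0r !normrN.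
    by move: i => [[|[|[|//]]] ?].
  by rewrite ltr_norml => /andP[? ?]; move: tM; case; lra.
apply: (@integral_derive_support _ (f \o F) _ (- M) M).
- lra.
- move=> t; apply: continuous_comp; last exact: cg.
  rewrite (_ : F = fun t => (t - Defs.coord x i) *: Defs.basis R i + x);
    last exact/funext.
  apply: continuousD; last exact: cst_continuous.
  apply: (@continuousZr_tmp _ _ _ (fun t => t - Defs.coord x i)).
  by apply: continuousB; [exact: id|exact: cst_continuous].
- move=> t.
  have df : is_derive (F t) (Defs.basis R i) f (g (F t)).
    exact: (derivableP (CnS_derivable (Kf.1 1))).
  apply/is_derive_line.
  rewrite (_ : (fun h : R => _) = (fun h => f (h *: Defs.basis R i + F t))).
    exact/is_derive_line.
  apply/funext => h /=; rewrite !FE [h%:A]mulr1 addrA -scalerDl addrA.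
  by rewrite [h + _]addrC.
- by move=> t /off; exact: Kf.2.
- by move=> t tM; apply: Kg.2; apply: off; case: tM => /ltW; [left|right].
Qed.
Let bg : exists M, forall x, `|g x| <= M.
Proof. exact: smooth_off_bounded Kg. Qed.

Lemma integral_pderiv : (\int[vol R]_x (pderiv i f x)%:E = 0)%E.
Proof.
have [M M0 KM] := bounded_sub_box (compact_bounded cK).
have [C gC] := bg.
have intg := integrable_smooth_off cK Kg.
apply: (@vol_integral_slice0 _ g i) => // [z|F x FE]; last exact: slice M0 KM FE.
apply: (@integrable_bounded_support _ _ _ (@area R) (ball 0 M `*` ball 0 M) _ C).
- by apply: measurableX; exact: measurable_ball1.
- by have := area_square (ltW M0) => /= ->; rewrite ltry.
- by apply: (measurableT_comp mg); exact: pair2_measurable.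
- by move=> x; exact: gC.
- by move=> x xM; apply: Kg.2 => /KM [].
Qed.

End integral_pderiv.

(** * Complex-valued integrals *)

Section complex_parts.
Variable R : realType.

Lemma complex_ReM (z w : R[i]) : complex.Re (z * w) =
  complex.Re z * complex.Re w - complex.Im z * complex.Im w.
Proof. by case: z w => [a b] [a' b']. Qed.

Lemma complex_ImM (z w : R[i]) : complex.Im (z * w) =
  complex.Re z * complex.Im w + complex.Im z * complex.Re w.
Proof. by case: z w => [a b] [a' b']. Qed.

Lemma complex_ReC (r : R) : complex.Re r%:C = r. Proof. by []. Qed.

Lemma complex_ImC (r : R) : complex.Im r%:C = 0. Proof. by []. Qed.

Lemma complex_ReD (z w : R[i]) :
  complex.Re (z + w) = complex.Re z + complex.Re w.
Proof. by case: z w => [a b] [a' b']. Qed.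

Lemma complex_ImD (z w : R[i]) :
  complex.Im (z + w) = complex.Im z + complex.Im w.
Proof. by case: z w => [a b] [a' b']. Qed.

Lemma eq_complexP (z w : R[i]) :
  complex.Re z = complex.Re w -> complex.Im z = complex.Im w -> z = w.
Proof. by case: z w => [a b] [a' b'] /= -> ->. Qed.

Lemma complex_ReN (z : R[i]) : complex.Re (- z) = - complex.Re z.
Proof. by case: z. Qed.

Lemma complex_ImN (z : R[i]) : complex.Im (- z) = - complex.Im z.
Proof. by case: z. Qed.

End complex_parts.

Section cintegral.
Context d (T : measurableType d) (R : realType) (mu : {measure set T -> \bar R}).
Variable D : set T.
Hypothesis mD : measurable D.
Implicit Types f g : T -> R[i].

Definition cmeasurable f := measurable_fun D (fun x => complex.Re (f x)) /\
  measurable_fun D (fun x => complex.Im (f x)).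

Definition cintegrable f :=
  mu.-integrable D (fun x => (complex.Re (f x))%:E) /\
  mu.-integrable D (fun x => (complex.Im (f x))%:E).

Lemma Re_cintegral f : complex.Re (cintegral mu D f) =
  \int[mu]_(x in D) complex.Re (f x).
Proof. by []. Qed.

Lemma Im_cintegral f : complex.Im (cintegral mu D f) =
  \int[mu]_(x in D) complex.Im (f x).
Proof. by []. Qed.

Lemma cmeasurableM f g : cmeasurable f -> cmeasurable g ->
  cmeasurable (fun x => f x * g x).
Proof.
move=> [f1 f2] [g1 g2]; split.
  under eq_fun do rewrite complex_ReM.
  by apply: measurable_funB; exact: measurable_funM.
under eq_fun do rewrite complex_ImM.
by apply: measurable_funD; exact: measurable_funM.
Qed.

Lemma cmeasurable_conj f : cmeasurable f -> cmeasurable (fun x => conjc (f x)).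
Proof.
move=> [f1 f2]; split.
  by rewrite (_ : (fun _ => _) = (fun x => complex.Re (f x)))//;
    apply/funext => x; case: (f x).
rewrite (_ : (fun _ => _) = (fun x => - complex.Im (f x))).
  exact: measurableT_comp.
by apply/funext => x; case: (f x).
Qed.

Lemma cmeasurable_cst c : cmeasurable (fun=> c).
Proof. by split; exact: measurable_cst. Qed.

Lemma cmeasurable_real (h : T -> R) : measurable_fun D h ->
  cmeasurable (fun x => (h x)%:C).
Proof. by move=> mh; split => //; exact: measurable_cst. Qed.

Lemma eq_cintegral f g : (forall x, D x -> f x = g x) ->
  cintegral mu D f = cintegral mu D g.
Proof.
move=> fg; rewrite /cintegral; congr Complex; apply: eq_Rintegral => x.
  by rewrite inE => /fg ->.
by rewrite inE => /fg ->.
Qed.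

Lemma cintegral0 : cintegral mu D (fun=> 0) = 0.
Proof. by rewrite /cintegral /= /Rintegral integral0. Qed.

Lemma ae_eq_cintegral f g : cmeasurable f -> cmeasurable g ->
  {ae mu, forall x, D x -> f x = g x} -> cintegral mu D f = cintegral mu D g.
Proof.
move=> [f1 f2] [g1 g2] fg; rewrite /cintegral /Rintegral.
by congr Complex; congr fine; apply: ae_eq_integral => //;
  do ?[exact/measurable_EFinP]; apply: filterS fg => x /[apply] ->.
Qed.

Lemma cintegral_mul0 f : cintegral mu D (fun x => 0 * f x) = 0.
Proof.
by rewrite -[RHS]cintegral0; apply: eq_cintegral => x _; rewrite mul0r.
Qed.

Lemma cintegrableD f g : cintegrable f -> cintegrable g ->
  cintegrable (fun x => f x + g x).
Proof.
move=> [f1 f2] [g1 g2]; split.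
  under eq_fun do rewrite complex_ReD EFinD.
  exact: integrableD.
under eq_fun do rewrite complex_ImD EFinD.
exact: integrableD.
Qed.

Lemma cintegralD f g : cintegrable f -> cintegrable g ->
  cintegral mu D (fun x => f x + g x) = cintegral mu D f + cintegral mu D g.
Proof.
move=> [f1 f2] [g1 g2]; rewrite /cintegral.
under eq_Rintegral do rewrite complex_ReD.
under [X in _ +i* X]eq_Rintegral do rewrite complex_ImD.
by rewrite !RintegralD.
Qed.

Let integrableZE r (h : T -> R) : mu.-integrable D (EFin \o h) ->
  mu.-integrable D (EFin \o (fun x => r * h x)).
Proof. exact: integrableZl. Qed.

Lemma cintegralZ c f : cintegrable f ->
  cintegral mu D (fun x => c * f x) = c * cintegral mu D f.
Proof.
move=> [f1 f2]; apply: eq_complexP.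
  rewrite complex_ReM /=; under eq_Rintegral do rewrite complex_ReM.
  by rewrite RintegralB ?RintegralZl//; exact: integrableZE.
rewrite complex_ImM /=; under eq_Rintegral do rewrite complex_ImM.
by rewrite RintegralD ?RintegralZl//; exact: integrableZE.
Qed.

Lemma cintegrableZ c f : cintegrable f -> cintegrable (fun x => c * f x).
Proof.
move=> [f1 f2]; split.
  under eq_fun do rewrite complex_ReM EFinB.
  by apply: integrableB => //; exact: integrableZE.
under eq_fun do rewrite complex_ImM EFinD.
by apply: integrableD => //; exact: integrableZE.
Qed.

Lemma cintegral_conj f : cintegrable f ->
  cintegral mu D (fun x => conjc (f x)) = conjc (cintegral mu D f).
Proof.
move=> [f1 f2]; apply: eq_complexP => /=.
  by apply: eq_Rintegral => x _; case: (f x).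
rewrite -mulN1r -RintegralZl//.
by apply: eq_Rintegral => x _; case: (f x) => ? ? /=; rewrite mulN1r.
Qed.

Lemma cintegrable_conj f : cintegrable f -> cintegrable (fun x => conjc (f x)).
Proof.
move=> [f1 f2]; split.
  by rewrite (_ : (fun _ => _) = (fun x => (complex.Re (f x))%:E))//;
    apply/funext => x; case: (f x).
rewrite (_ : (fun _ => _) = (fun x => (- (complex.Im (f x))%:E)%E)).
  exact: integrableN.
by apply/funext => x; case: (f x).
Qed.

Lemma cintegrableMr f (h : T -> R) : measurable_fun D h ->
  (exists M, forall x, `|h x| <= M) -> cintegrable f ->
  cintegrable (fun x => f x * (h x)%:C).
Proof.
move=> mh [M hM] [f1 f2].
have bh : [bounded h x | x in D].
  exists M; split; first exact: num_real.
  by move=> N MN x _ /=; rewrite (le_trans (hM x))// ltW.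
split.
  under eq_fun do
    rewrite complex_ReM complex_ReC complex_ImC mulr0 subr0 mulrC EFinM.
  exact: integrableMr.
under eq_fun do
    rewrite complex_ImM complex_ReC complex_ImC mulr0 add0r mulrC EFinM.
exact: integrableMr.
Qed.

(** Both parts are dominated by 1 + |f|^2, which is integrable because [D] has finite measure. *)
Lemma inL2_cintegrable f : (mu D < +oo)%E -> inL2 mu D f -> cintegrable f.
Proof.
move=> Doo [f1 f2 foo].
have int1 : mu.-integrable D (fun x => (1 + sqabs (f x))%:E).
  under eq_fun do rewrite EFinD.
  apply: integrableD => //.
    apply: (@measurable_bounded_integrable _ _ _ _ (cst 1)) => //.
    exists 1; split; first exact: num_real.
    by move=> N N1 x _ /=; rewrite normr1 ltW.
  apply/integrableP; split.
    apply/measurable_EFinP; apply: measurable_funD; exact: measurable_funX.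
  under eq_integral do rewrite gee0_abs ?lee_fin ?addr_ge0 ?sqr_ge0//.
  exact: foo.
split; apply: (le_integrable mD _ _ int1); do ?exact/measurable_EFinP.
all: move=> x _ /=; rewrite lee_fin /sqabs.
all: rewrite [leRHS]ger0_norm ?addr_ge0 ?sqr_ge0//.
all: move: (complex.Re _) (complex.Im _) => s t.
(* Expanding (|s| - 1)^2 >= 0 gives 2|s| <= 1 + s^2. *)
- have := sqr_ge0 (`|s| - 1); have := sqr_ge0 t.
  rewrite sqrrB1 real_normK ?num_real//.
  have := normr_ge0 s; have := sqr_ge0 s; lra.
- have := sqr_ge0 (`|t| - 1); have := sqr_ge0 s.
  rewrite sqrrB1 real_normK ?num_real//.
  have := normr_ge0 t; have := sqr_ge0 t; lra.
Qed.

End cintegral.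

Lemma Rintegral_off (R : realType) (D : set (R3 R)) (f : R3 R -> R) :
  (forall x, ~ D x -> f x = 0) ->
  \int[vol R]_(x in D) f x = \int[vol R]_x f x.
Proof.
move=> f0; rewrite Rintegral_mkcond; apply: eq_Rintegral => x _.
by rewrite patchE; case: ifPn => //; rewrite notin_setE => /f0.
Qed.

(** The product [f * psi] vanishes off [K] even if [psi] does not, so its partial derivative has
    integral zero over the whole space; both integrands vanish off [D]. *)
Lemma integration_by_parts_smooth_off (R : realType) (D K : set (R3 R))
    (f psi : R3 R -> R) (i : 'I_3) :
  compact K -> K `<=` D -> smooth_off K f -> smooth psi ->
  \int[vol R]_(x in D) (f x * pderiv i psi x) =
  - \int[vol R]_(x in D) (pderiv i f x * psi x).
Proof.
move=> cK KD Kf spsi.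
have clK : closed K by exact: compact_closed.
have Kpf := smooth_off_pderiv i clK Kf.
have K1 : smooth_off K (fun x => f x * pderiv i psi x).
  by apply: smooth_offM => // n; exact: CnS_pderiv.
have K2 : smooth_off K (fun x => pderiv i f x * psi x) by exact: smooth_offM.
have off g : smooth_off K g -> forall x, ~ D x -> g x = 0.
  by move=> Kg x Dx; apply: Kg.2 => /KD.
rewrite (Rintegral_off (off _ K1)) (Rintegral_off (off _ K2)).
apply/eqP; rewrite -addr_eq0 -RintegralD//;
  [|exact: integrable_smooth_off cK K1|exact: integrable_smooth_off cK K2].
have := integral_pderiv i cK (smooth_offM Kf spsi).
rewrite (pderivM i (Kf.1 1) (spsi 1)) /Rintegral => E.
by rewrite [X in fine X == _](_ : _ = 0%E)// -[RHS]E;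
  apply: eq_integral => x _; rewrite [psi x * _]mulrC.
Qed.

(** * Smooth complex fields as elements of L^2 and H^1, and their traces *)

Definition csmooth_off (R : realType) (K : set (R3 R)) (u : R3 R -> R[i]) :=
  smooth_off K (fun x => complex.Re (u x)) /\
  smooth_off K (fun x => complex.Im (u x)).

Lemma csmooth_off0 (R : realType) (K : set (R3 R)) : csmooth_off K (fun=> 0).
Proof. by split; exact: smooth_off0. Qed.

Lemma csmooth_offZ (R : realType) (K : set (R3 R)) (c : R[i]) (f : R3 R -> R) :
  smooth_off K f -> csmooth_off K (fun x => c * (f x)%:C).
Proof.
move=> Kf; split.
  under eq_fun do rewrite complex_ReM complex_ReC complex_ImC mulr0 subr0.
  exact: smooth_offZ.
under eq_fun do rewrite complex_ImM complex_ReC complex_ImC mulr0 add0r.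
exact: smooth_offZ.
Qed.

Lemma cgradZ (R : realType) (K : set (R3 R)) (c : R[i]) (f : R3 R -> R) :
  smooth_off K f ->
  cgrad (fun x => c * (f x)%:C) = fun i x => c * (pderiv i f x)%:C.
Proof.
move=> Kf; apply/funext => i; apply/funext => x; rewrite /cgrad.
apply: eq_complexP => /=.
  under eq_fun do rewrite complex_ReM complex_ReC complex_ImC mulr0 subr0.
  by rewrite (pderivZ _ _ (Kf.1 1)) complex_ReM
    complex_ReC complex_ImC mulr0 subr0.
under eq_fun do rewrite complex_ImM complex_ReC complex_ImC mulr0 add0r.
by rewrite (pderivZ _ _ (Kf.1 1)) complex_ImM
    complex_ReC complex_ImC mulr0 add0r.
Qed.

Lemma csmooth_off_cgrad (R : realType) (K : set (R3 R)) (u : R3 R -> R[i]) i :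
  closed K -> csmooth_off K u -> csmooth_off K (cgrad u i).
Proof. by move=> cK [u1 u2]; split; exact: smooth_off_pderiv. Qed.

Lemma csmooth_off_inL2 (R : realType) (D K : set (R3 R)) (u : R3 R -> R[i]) :
  open D -> compact K -> csmooth_off K u -> inL2 (vol R) D u.
Proof.
move=> oD cK [u1 u2]; have mD := open_measurable3 oD.
have c1 := Cn_continuous (u1.1 0); have c2 := Cn_continuous (u2.1 0).
split; [exact: continuous_measurable3|exact: continuous_measurable3|].
have Ks : smooth_off K (fun x => sqabs (u x)).
  by apply: smooth_offD; apply: smooth_offM => //; [exact: u1.1|exact: u2.1].
have /integrableP[_] : (vol R).-integrable D (EFin \o (fun x => sqabs (u x))).
  by apply: integrableS (integrable_smooth_off cK Ks).
apply: le_lt_trans; rewrite le_eqVlt; apply/orP; left; apply/eqP.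
by apply: eq_integral => x _; rewrite /= ger0_norm// addr_ge0// sqr_ge0.
Qed.

Lemma csmooth_off_inH1 (R : realType) (D K : set (R3 R)) (u : R3 R -> R[i]) :
  open D -> compact K -> K `<=` D -> csmooth_off K u -> inH1 D u (cgrad u).
Proof.
move=> oD cK KD Ku; have clK : closed K by exact: compact_closed.
split=> [|i|psi [spsi _ _] i].
- exact: csmooth_off_inL2 Ku.
- exact: csmooth_off_inL2 (csmooth_off_cgrad i clK Ku).
case: Ku => u1 u2; apply: eq_complexP;
  rewrite ?complex_ReN ?complex_ImN ?Re_cintegral ?Im_cintegral.
  under eq_Rintegral do rewrite complex_ReM complex_ReC complex_ImC mulr0 subr0.
  under [in RHS]eq_Rintegral do
    rewrite complex_ReM complex_ReC complex_ImC mulr0 subr0.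
  exact: (integration_by_parts_smooth_off i cK KD u1 spsi).
under eq_Rintegral do rewrite complex_ImM complex_ReC complex_ImC mulr0 add0r.
under [in RHS]eq_Rintegral do
    rewrite complex_ImM complex_ReC complex_ImC mulr0 add0r.
exact: (integration_by_parts_smooth_off i cK KD u2 spsi).
Qed.

Lemma inL2_0 d (T : measurableType d) (R : realType)
    (mu : {measure set T -> \bar R}) (D : set T) : inL2 mu D (fun=> 0 : R[i]).
Proof.
split; [exact: measurable_cst|exact: measurable_cst|].
rewrite /sqL2norm integral0_eq// => x _.
by rewrite /sqabs /= expr0n /= addr0.
Qed.

Lemma sqL2norm0 d (T : measurableType d) (R : realType)
    (mu : {measure set T -> \bar R}) (D : set T) (f : T -> R[i]) :
  (forall x, D x -> f x = 0) -> sqL2norm mu D f = 0%E.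
Proof.
move=> f0; rewrite /sqL2norm integral0_eq// => x /f0 ->.
by rewrite /sqabs /= expr0n /= addr0.
Qed.

(** Such a [u] is itself a test function on the whole space, so the constant sequence [u] is an
    admissible approximation. *)
Lemma has_trace_csmooth_off (R : realType) (D S K : set (R3 R))
    (u : R3 R -> R[i]) :
  compact K -> csmooth_off K u -> inH1 D u (cgrad u) ->
  (forall x, S x -> u x = 0) -> has_trace D S u (fun=> 0).
Proof.
move=> cK [u1 u2] uH1 u0; have clK : closed K by exact: compact_closed.
split; first exact: inL2_0.
exists (cgrad u); split=> //; exists (fun=> u); split.
- by move=> _; split; [apply: smooth_off_test cK clK _ u1|
                       apply: smooth_off_test cK clK _ u2].
- rewrite [X in X @ _](_ : _ = cst 0%E); first exact: cvg_cst.
  apply/funext => n /=; rewrite /sqH1norm big1 => [|i _];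
    by rewrite sqL2norm0 ?adde0// => x _; rewrite subrr.
- rewrite [X in X @ _](_ : _ = cst 0%E); first exact: cvg_cst.
  by apply/funext => n /=; rewrite sqL2norm0// => x /u0 ->; rewrite subrr.
Qed.

(** * Smooth solutions of the Direct Problem *)

Lemma ae_imply d (T : measurableType d) (R : realType)
    (mu : {measure set T -> \bar R}) (P Q : T -> Prop) :
  (forall x, P x -> Q x) -> {ae mu, forall x, P x} -> {ae mu, forall x, Q x}.
Proof. by move=> PQ; apply: filterS. Qed.

Lemma inH1_0 (R : realType) (D : set (R3 R)) : inH1 D (fun=> 0) (fun _ _ => 0).
Proof.
split=> [|i|psi _ i]; [exact: inL2_0|exact: inL2_0|].
by rewrite !cintegral_mul0 oppr0.
Qed.

Lemma cgrad0 (R : realType) : cgrad (fun _ : R3 R => 0) = fun _ _ => 0.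
Proof.
by apply/funext => i; apply/funext => x; rewrite /cgrad /= pderiv_cst.
Qed.

Lemma has_trace0 (R : realType) (D S : set (R3 R)) :
  has_trace D S (fun=> 0) (fun=> 0).
Proof.
apply: (has_trace_csmooth_off (@compact0 _) (csmooth_off0 set0)) => //.
by rewrite cgrad0; exact: inH1_0.
Qed.

Lemma innerL2_0l d (T : measurableType d) (R : realType)
    (mu : {measure set T -> \bar R}) (D : set T) (f : T -> R[i]) :
  innerL2 mu D (fun=> 0) f = 0.
Proof.
exact: cintegral_mul0.
Qed.

Lemma exterior_solution0 (R : realType) (Omega : set (R3 R)) (k : R) :
  exterior_solution Omega k (fun=> 0) (fun=> 0) (fun _ _ => 0).
Proof.
split.
- by move=> rho; exact: inH1_0.
- by move=> psi _; exact: cintegral_mul0.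
- by move=> x _; split => /=; exact: differentiable_cst.
- by move=> rho _; exact: has_trace0.
- move=> eps e0; exists 0 => x _.
  rewrite mulr0 subr0 /radial_deriv /= !derive_cst /sqabs /= expr0n /= addr0 mulr0.
  by rewrite exprn_gt0.
Qed.

(** With the zero exterior field as witness, both terms of Green's formula vanish. *)
Lemma is_DtN0 (R : realType) (Omega : set (R3 R)) (k : R) :
  is_DtN Omega k (fun=> 0) (fun=> 0).
Proof.
exists (fun=> 0), (fun _ _ => 0); split; first exact: exterior_solution0.
move=> w Dw psi _ _ _.
by rewrite /innerL2v big1 => [|i _]; rewrite innerL2_0l// mulr0 oppr0 addr0.
Qed.

Definition helmholtz (R : realType) (k : R) (f : R3 R -> R) : R3 R -> R :=
  fun x => - laplacian f x - k ^+ 2 * f x.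

Lemma smooth_off_helmholtz (R : realType) (K : set (R3 R)) (k : R)
    (f : R3 R -> R) :
  closed K -> smooth_off K f -> smooth_off K (helmholtz k f).
Proof.
move=> cK Kf; rewrite /helmholtz.
under eq_fun do rewrite -mulN1r -mulNr.
by apply: smooth_offD; apply: smooth_offZ => //; exact: smooth_off_laplacian.
Qed.

Section direct_solution.
Variables (R : realType) (Omega K : set (R3 R)) (a b : R3 R -> R).
Variables (k : R) (c : R[i]).
Hypothesis oO : open Omega.
Hypothesis bO : bounded_set Omega.
Hypothesis ma : measurable_fun Omega (a : mR3 R -> R).
Hypothesis mb : measurable_fun Omega (b : mR3 R -> R).
Hypothesis cK : compact K.
Hypothesis KO : K `<=` Omega.
Hypothesis aK : {ae vol R, forall x, K x -> a x = 1}.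
Hypothesis bK : {ae vol R, forall x, K x -> b x = 1}.

Let mO : measurable (Omega : set (mR3 R)). Proof. exact: open_measurable3. Qed.
Let Ooo : (vol R Omega < +oo)%E. Proof. exact: vol_bounded. Qed.
Let clK : closed K. Proof. exact: compact_closed. Qed.

Let smooth_off_real f : smooth_off K f -> measurable_fun Omega (f : mR3 R -> R).
Proof.
by move=> Kf; apply: continuous_measurable3 => //; exact: Cn_continuous (Kf.1 0%N).
Qed.

Let inL2_cmeasurable v : inL2 (vol R) Omega v -> cmeasurable Omega (v : mR3 R -> R[i]).
Proof. by case. Qed.

(** [weak_gradient] is stated with an unconjugated integral and real test functions, whereas the
    Direct Problem conjugates [v]; for real [f] the two differ by an outer conjugation. *)
Lemma innerL2_real_conj f v : smooth_off K f -> inL2 (vol R) Omega v ->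
  innerL2 (vol R) Omega (fun x => (f x)%:C) v =
  conjc (cintegral (vol R) Omega (fun x => v x * (f x)%:C)).
Proof.
move=> Kf vL2; rewrite -cintegral_conj//.
  apply: eq_cintegral => x _; case: (v x) => s t; apply: eq_complexP;
  by rewrite /= ?complex_ReM ?complex_ImM /=; ring.
by apply: cintegrableMr => //; [exact: smooth_off_real|
  exact: smooth_off_bounded Kf|exact: inL2_cintegrable].
Qed.

Lemma cintegrable_real_conj f v : smooth_off K f -> inL2 (vol R) Omega v ->
  cintegrable (vol R) Omega (fun x => (f x)%:C * conjc (v x)).
Proof.
move=> Kf vL2.
rewrite (_ : (fun _ => _) = fun x => conjc (v x * (f x)%:C)).
  by apply/cintegrable_conj/cintegrableMr => //; [exact: smooth_off_real|
    exact: smooth_off_bounded Kf|exact: inL2_cintegrable].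
apply/funext => x; case: (v x) => s t; apply: eq_complexP;
by rewrite /= ?complex_ReM ?complex_ImM /=; ring.
Qed.

(** On [K] the coefficient is 1 almost everywhere, and off [K] the field is zero. This is how [a]
    and [b] disappear from the equation. *)
Lemma innerL2_coef f v e : measurable_fun Omega (e : mR3 R -> R) ->
  {ae vol R, forall x, K x -> e x = 1} ->
  smooth_off K f -> inL2 (vol R) Omega v ->
  innerL2 (vol R) Omega (fun x => (e x)%:C * (c * (f x)%:C)) v =
  c * innerL2 (vol R) Omega (fun x => (f x)%:C) v.
Proof.
move=> me eK Kf vL2; rewrite /innerL2 -cintegralZ//; last exact: cintegrable_real_conj.
have mv := cmeasurable_conj (inL2_cmeasurable vL2).
have mf := cmeasurable_real (smooth_off_real Kf).
apply: ae_eq_cintegral => //.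
- apply: cmeasurableM => //; apply: cmeasurableM; first exact: cmeasurable_real.
  by apply: cmeasurableM => //; exact: cmeasurable_cst.
- by apply: cmeasurableM; [exact: cmeasurable_cst|exact: cmeasurableM].
- apply: ae_imply eK => x ex _; have [/ex ->|/(Kf.2 x) ->] := pselect (K x).
    by rewrite mul1r mulrA.
  by rewrite !(mulr0, mul0r).
Qed.

(** Here [pderiv i f] is the test function in the definition of the weak gradient of [v]. *)
Lemma innerL2_weak_gradient f v Dv i : smooth_off K f -> inH1 Omega v Dv ->
  innerL2 (vol R) Omega (fun x => (pderiv i f x)%:C) (Dv i) =
  - innerL2 (vol R) Omega (fun x => (pderiv i (pderiv i f) x)%:C) v.
Proof.
move=> Kf [vL2 DvL2 wg]; have Kf' := smooth_off_pderiv i clK Kf.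
rewrite !innerL2_real_conj//; last exact: smooth_off_pderiv.
by rewrite wg ?rmorphN ?opprK//; exact: smooth_off_test Kf'.
Qed.

(** The constant [c] stands for h(k): it multiplies the source in the Direct Problem, hence also the
    field. Moving the derivatives off [v] turns the form into the pairing of [helmholtz k f] with
    [v]. *)
Lemma direct_solution_smooth_off f : smooth_off K f ->
  direct_solution Omega a b k c (fun x => (helmholtz k f x)%:C)
    (fun x => c * (f x)%:C) /\
  int_trace Omega (fun x => c * (f x)%:C) (fun=> 0).
Proof.
move=> Kf; have Ku := csmooth_offZ c Kf.
have uH1 := csmooth_off_inH1 oO cK KO Ku.
have tr : int_trace Omega (fun x => c * (f x)%:C) (fun=> 0).
  apply: has_trace_csmooth_off cK Ku uH1 _ => x [_ Ox].
  by rewrite (Kf.2 x) ?mulr0// => /KO.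
split=> //; exists (cgrad (fun x => c * (f x)%:C)), (fun=> 0), (fun=> 0).
split=> //; first exact: is_DtN0.
move=> v Dv psi vH1 _; have [vL2 DvL2 _] := vH1.
rewrite subr0 (innerL2_coef mb bK Kf vL2) (cgradZ c Kf) /innerL2v.
rewrite (eq_bigr (fun i => - (c * innerL2 (vol R) Omega
    (fun x => (pderiv i (pderiv i f) x)%:C) v))); last first.
  move=> i _; rewrite (innerL2_coef ma aK (smooth_off_pderiv i clK Kf) (DvL2 i)).
  by rewrite (innerL2_weak_gradient i Kf vH1) mulrN.
pose F i x := (pderiv i (pderiv i f) x)%:C * conjc (v x).
have intF i : cintegrable (vol R) Omega (F i).
  by apply: cintegrable_real_conj => //; do 2 apply: smooth_off_pderiv => //.
have intf := cintegrable_real_conj Kf vL2.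
(* The sign is written as the scalar [- 1] so that linearity of the integral treats both terms
   alike. *)
have -> : innerL2 (vol R) Omega (fun x => (helmholtz k f x)%:C) v =
    - 1 * (\sum_i cintegral (vol R) Omega (F i)) +
    - (k ^+ 2)%:C * innerL2 (vol R) Omega (fun x => (f x)%:C) v.
  rewrite !big_ord_recr big_ord0 /= add0r -!cintegralD//; last exact: cintegrableD.
  rewrite /innerL2 -!cintegralZ//; last by do 2 apply: cintegrableD => //.
  rewrite -cintegralD//; [|by apply: cintegrableZ => //; do 2 apply: cintegrableD => //
                          |exact: cintegrableZ].
  apply: eq_cintegral => x _; rewrite /F /helmholtz /laplacian.
  rewrite !big_ord_recr big_ord0 /= add0r.
  move: (pderiv _ _ _) (pderiv _ _ _) (pderiv _ _ _) => p q r.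
  by case: (v x) => s t; apply: eq_complexP; rewrite ?complex_ReD ?complex_ImD
    ?complex_ReM ?complex_ImM ?complex_ReN ?complex_ImN /=; ring.
rewrite sumrN -mulr_sumr /innerL2 /F; ring.
Qed.

End direct_solution.

(** * Products of Helmholtz operators *)

Section laplacian_linear.
Variables (R : realType) (f g : R3 R -> R).
Hypotheses (sf : smooth f) (sg : smooth g).

Lemma laplacianD :
  laplacian (fun x => f x + g x) = fun x => laplacian f x + laplacian g x.
Proof.
apply/funext => x; rewrite /laplacian -big_split; apply: eq_bigr => i _ /=.
by rewrite (pderivD i (sf 1) (sg 1))
  (pderivD i (CnS_pderiv i (sf 2)) (CnS_pderiv i (sg 2))).
Qed.

Lemma laplacianZ c : laplacian (fun x => c * f x) = fun x => c * laplacian f x.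
Proof.
apply/funext => x; rewrite /laplacian mulr_sumr; apply: eq_bigr => i _ /=.
by rewrite (pderivZ i c (sf 1)) (pderivZ i c (CnS_pderiv i (sf 2))).
Qed.

End laplacian_linear.

Lemma helmholtzE (R : realType) (k : R) (f : R3 R -> R) :
  helmholtz k f = fun x => - 1 * laplacian f x + - k ^+ 2 * f x.
Proof. by apply/funext => x; rewrite /helmholtz mulN1r mulNr. Qed.

(** The expanded form is visibly symmetric in [k] and [l], which yields commutation. *)
Lemma helmholtz2 (R : realType) (K : set (R3 R)) (k l : R) (f : R3 R -> R) :
  closed K -> smooth_off K f ->
  helmholtz k (helmholtz l f) = fun x => laplacian (laplacian f) x +
    (k ^+ 2 + l ^+ 2) * laplacian f x + k ^+ 2 * l ^+ 2 * f x.
Proof.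
move=> cK Kf; have sL := (smooth_off_laplacian cK Kf).1.
have lap : laplacian (helmholtz l f) =
    fun x => - 1 * laplacian (laplacian f) x + - l ^+ 2 * laplacian f x.
  rewrite helmholtzE laplacianD; [|by move=> n; exact/CnZ/sL|by move=> n; exact/CnZ/Kf.1].
  by rewrite (laplacianZ sL) (laplacianZ Kf.1).
apply/funext => x; rewrite {1}/helmholtz lap /helmholtz.
move: (laplacian (laplacian f) x) (laplacian f x) => p q; ring.
Qed.

Lemma helmholtzC (R : realType) (K : set (R3 R)) (k l : R) (f : R3 R -> R) :
  closed K -> smooth_off K f ->
  helmholtz k (helmholtz l f) = helmholtz l (helmholtz k f).
Proof.
move=> cK Kf; rewrite (helmholtz2 k l cK Kf) (helmholtz2 l k cK Kf).
by apply/funext => x; rewrite [l ^+ 2 + _]addrC [l ^+ 2 * _]mulrC.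
Qed.

Definition helmholtz_prod (R : realType) (s : seq R) (f : R3 R -> R) :=
  foldr (@helmholtz R) f s.

Lemma smooth_off_helmholtz_prod (R : realType) (K : set (R3 R)) (s : seq R)
    (f : R3 R -> R) :
  closed K -> smooth_off K f -> smooth_off K (helmholtz_prod s f).
Proof. by move=> cK Kf; elim: s => //= k s; exact: smooth_off_helmholtz. Qed.

(** Commutation carries the factor of [k] to the front; the remaining product is then, up to h(k),
    the solution at frequency [k]. *)
Lemma helmholtz_prod_rem (R : realType) (K : set (R3 R)) (s : seq R)
    (k : R) (f : R3 R -> R) : closed K -> smooth_off K f -> k \in s ->
  helmholtz_prod s f = helmholtz k (helmholtz_prod (rem k s) f).
Proof.
move=> cK Kf; elim: s => //= l s IH; rewrite inE eq_sym.
have [->//|/= _ /IH ->] := eqVneq l k.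
exact: helmholtzC (smooth_off_helmholtz_prod _ cK Kf).
Qed.

(** Otherwise [f] would be nonzero on a nonempty open set, which has positive volume. Almost
    everywhere uniqueness thus becomes equality of functions, to which the next factor can be
    applied. *)
Lemma ae_eq0_continuous (R : realType) (D : set (R3 R)) (f : R3 R -> R) :
  open D -> continuous f -> {ae vol R, forall x, D x -> f x = 0} ->
  forall x, D x -> f x = 0.
Proof.
move=> oD cf [B [mB B0 DB]] x Dx; apply: contrapT => fx.
have oA : open (D `&` f @^-1` [set~ 0]).
  apply: openI => //; apply: open_comp => [y _|]; first exact: cf.
  by apply: closed_openC; exact: closed_eq.
have := vol_open_gt0 oA (ex_intro _ x (conj Dx fx)).
rewrite ltNge => /negP; apply; rewrite -B0.
apply: le_measure; rewrite ?inE//; first exact: open_measurable3.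
by move=> y [Dy fy]; apply: DB => /(_ Dy).
Qed.

(** Without boundary points [D] would be closed, hence compact, and the first coordinate would
    attain a maximum on it; openness allows a further step in that direction. *)
Lemma boundary_neq0 (R : realType) (D : set (R3 R)) :
  open D -> D !=set0 -> bounded_set D -> boundary D !=set0.
Proof.
move=> oD D0 bD; apply: contrapT => nb.
have clD : closed D.
  by move=> x cx; apply: contrapT => Dx; apply: nb; exists x.
have [M M0 DM] := bounded_sub_box bD.
have cD : compact D.
  apply: (subclosed_compact clD (@compact_closed_box R 0 M)) => x /DM.
  move=> [[/= + +] +]; rewrite /ball/= !sub0r !normrN !ltr_norml.
  move=> /andP[? ?] /andP[? ?] /andP[? ?].
  by split; [split|]; rewrite /= in_itv/=; apply/andP; split; lra.
have [|c] := @compact_EVT_max _ R (fun x : R3 R => x.1.1) D D0 cD.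
  apply: continuous_subspaceT => x; exact: (continuous_comp cvg_fst cvg_fst).
rewrite inE => Dc cmax.
have /nbhs_ballP[e /= e0 ceD] := open_nbhs_nbhs (conj oD Dc).
have /cmax : (c.1.1 + e / 2, c.1.2, c.2) \in D.
  rewrite inE; apply: ceD; split; [split|]; rewrite /ball/= ?subrr ?normr0//.
  by rewrite opprD addrA subrr sub0r normrN gtr0_norm; lra.
by rewrite /=; lra.
Qed.

Lemma box_coef1 (R : realType) (Omega : set (R3 R)) (a b : R3 R -> R) :
  open Omega -> Omega !=set0 -> bounded_set Omega ->
  ess_support Omega (fun x => 1 - a x) `<=` Omega ->
  ess_support Omega (fun x => 1 - b x) `<=` Omega ->
  exists c r, [/\ 0 < r, closed_box c r `<=` Omega,
    {ae vol R, forall x, closed_box c r x -> a x = 1} &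
    {ae vol R, forall x, closed_box c r x -> b x = 1}].
Proof.
move=> oO O0 bO sa sb; have [x0 [clx0 Ox0]] := boundary_neq0 oO O0 bO.
(* The point [x0] is outside [Omega], hence outside both supports. It also lies in the closure of
   [Omega], so every ball around it contains a small box of [Omega]. *)
have near e : ess_support Omega e `<=` Omega -> exists U, nbhs x0 U /\
    (vol R).-negligible (U `&` Omega `&` [set y | e y != 0]).
  move=> se; apply: contrapT => nU; apply: Ox0; apply: se => U Ux nUO.
  by apply: nU; exists U.
have [U [Ux0 nU]] := near _ sa; have [V [Vx0 nV]] := near _ sb.
have [e /= e0 eUV] := (nbhs_ballP _ _).1 (filterI Ux0 Vx0).
have [c [Oc ce]] := clx0 _ (nbhsx_ballx x0 e e0).
have oB : open (ball x0 e `&` Omega) by apply: openI => //; exact: ball_open.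
have [r /= r0 rB] := (nbhs_ballP _ _).1 (open_nbhs_nbhs (conj oB (conj ce Oc))).
have KB : closed_box c (r / 2) `<=` ball x0 e `&` Omega.
  by move=> x /(closed_box_sub (ltac:(lra) : r / 2 < r)); rewrite -ball_box; exact: rB.
exists c, (r / 2); split; first lra.
- by move=> x /KB[].
- apply: negligibleS nU => x /= /not_implyP[Kx ax]; have [/eUV[Ux _] Ox] := KB _ Kx.
  by split => //=; rewrite subr_eq0 eq_sym; exact/eqP.
- apply: negligibleS nV => x /= /not_implyP[Kx ax]; have [/eUV[_ Vx] Ox] := KB _ Kx.
  by split => //=; rewrite subr_eq0 eq_sym; exact/eqP.
Qed.

Theorem mainTheorem3 (R : realType)
    (Omega : set (R3 R)) (a b : R3 R -> R) (a0 : R) (h : R -> R[i])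
    (* Omega is a bounded domain with Lipschitz boundary *)
    (Omega_open : open Omega) (Omega_nonempty : Omega !=set0)
    (Omega_connected : connected Omega) (Omega_bounded : bounded_set Omega)
    (Omega_lipschitz : lipschitz_boundary Omega)
    (* assumptions on the coefficients *)
    (a_bounded : inLinfty Omega a) (b_bounded : inLinfty Omega b)
    (a0_gt0 : 0 < a0)
    (a_ge : {ae vol R, forall x, Omega x -> a0 <= a x})
    (b_gt0 : {ae vol R, forall x, Omega x -> 0 < b x})
    (binv_bounded : inLinfty Omega (fun x => (b x)^-1))
    (a_supp : ess_support Omega (fun x => 1 - a x) `<=` Omega)
    (b_supp : ess_support Omega (fun x => 1 - b x) `<=` Omega)
    (h_neq0 : forall k, 0 < k -> h k != 0)
    (* well-posedness, taken as known *)
    (ext_wp : forall k, 0 < k -> exterior_well_posed Omega k)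
    (dir_wp : forall k, 0 < k -> direct_well_posed Omega a b k (h k))
    (* finitely many distinct frequencies *)
    (J : nat) (k : 'I_J -> R) (k_inj : injective k) (k_gt0 : forall j, 0 < k j) :
  (exists g : R3 R -> R[i],
    [/\ inL2 (vol R) Omega g,
        ~ {ae vol R, forall x, Omega x -> g x = 0} &
        forall j, non_radiating Omega a b (k j) (h (k j)) g])
  /\
  ~ (forall f f' : R3 R -> R[i],
      inL2 (vol R) Omega f -> inL2 (vol R) Omega f' ->
      (forall j, same_boundary_data Omega a b (k j) (h (k j)) f f') ->
      {ae vol R, forall x, Omega x -> f x = f' x}).
Proof.
have [c [r [r0 KO aK bK]]] :=
  box_coef1 Omega_open Omega_nonempty Omega_bounded a_supp b_supp.
set K := closed_box c r in KO aK bK.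
have cK : compact K by exact: compact_closed_box.
have clK : closed K by exact: compact_closed.
have ds kk := direct_solution_smooth_off kk (h kk) Omega_open
  Omega_bounded a_bounded.1 b_bounded.1 cK KO aK bK.
have smooth_ae0 (f : R3 R -> R) : smooth_off K f ->
    {ae vol R, forall x, Omega x -> f x = 0} -> f = fun=> 0.
  move=> Kf f0; apply/funext => x; have [Ox|Ox] := pselect (Omega x).
    exact: ae_eq0_continuous (Cn_continuous (Kf.1 0)) f0 x Ox.
  by apply: Kf.2 => /KO.
have src0 kk : (fun x => (helmholtz kk (fun _ : R3 R => 0) x)%:C) = fun=> 0 :> R[i].
  apply/funext => x; rewrite /helmholtz /laplacian mulr0 big1 ?oppr0 ?addr0// => i _.
  by rewrite !pderiv_cst.
have inj_helmholtz kk (f : R3 R -> R) : 0 < kk -> smooth_off K f ->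
    helmholtz kk f = (fun=> 0) -> f = fun=> 0.
  move=> kk0 Kf f0; apply: smooth_ae0 => //.
  have [_ uniq_sol _] := dir_wp kk kk0.
  have [df _] := ds kk f Kf; have [d0 _] := ds kk _ (smooth_off0 K).
  rewrite f0 in df; rewrite src0 in d0.
  (* Uniqueness compares h(k) f with h(k) 0, and h(k) cancels because it is nonzero. *)
  apply: ae_imply (uniq_sol _ _ _ (inL2_0 _ _) df d0) => x fx Ox.
  move: (fx Ox) => /(mulfI (h_neq0 kk kk0)).
  by move/(congr1 (@complex.Re R)).
pose w := box_bump c r; have Kw : smooth_off K w by exact: smooth_off_box_bump.
pose s := [seq k j | j : 'I_J].
(* Factors are stripped one at a time. The inclusion in [s] keeps every frequency positive, as
   injectivity requires; with no factor left, the bump is nonzero at its centre [c]. *)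
have prod_neq0 t : {subset t <= s} -> helmholtz_prod t w <> fun=> 0.
  elim: t => [_ /(congr1 (fun f : R3 R -> R => f c))|kk t IH ts].
    by apply/eqP; exact: box_bump_neq0.
  have kk0 : 0 < kk.
    by have /ts/mapP[j _ ->] := mem_head kk t; exact: k_gt0.
  move=> /(inj_helmholtz _ _ kk0 (smooth_off_helmholtz_prod t clK Kw)).
  by apply: IH => l lt; apply: ts; rewrite inE lt orbT.
pose g := helmholtz_prod s w.
have Kg : smooth_off K g by exact: smooth_off_helmholtz_prod.
have gL2 : inL2 (vol R) Omega (fun x => (g x)%:C).
  by apply: csmooth_off_inL2 Omega_open cK _; split=> //; exact: smooth_off0.
have gn0 : ~ {ae vol R, forall x, Omega x -> (g x)%:C = 0}.
  move=> g0; apply: (prod_neq0 s) => //; apply: smooth_ae0 => //.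
  by apply: ae_imply g0 => x gx /gx [].
pose u j x := h (k j) * (helmholtz_prod (rem (k j) s) w x)%:C.
have usol j : direct_solution Omega a b (k j) (h (k j)) (fun x => (g x)%:C) (u j)
    /\ int_trace Omega (u j) (fun=> 0).
  rewrite /g (helmholtz_prod_rem clK Kw (map_f k (mem_enum _ j))).
  exact: ds (smooth_off_helmholtz_prod _ clK Kw).
split.
  exists (fun x => (g x)%:C); split => // j; exists (u j); exact: usol.
(* The sources [g] and 0 have the same zero trace at every frequency, so unique recovery would force
   g = 0. The solution for source 0 appears as h(k_j) times 0, the form produced by [ds]. *)
move=> uniq_src; apply: gn0.
apply: (uniq_src (fun x => (g x)%:C) (fun=> 0)) => //; first exact: inL2_0.
move=> j; have [d0 t0] := ds (k j) _ (smooth_off0 K); have [dj tj] := usol j.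
by rewrite src0 in d0; exists (u j), (fun=> h (k j) * 0%:C), (fun=> 0).
Qed.
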